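(* Let $G$ be any torsion-free group, let $\mathbb{F}$ be an arbitrary field, and let $\delta$ and $\gamma$ be elements of the group algebra $\mathbb{F}[G]$. If $|supp(\delta)|=3$ and $\delta\gamma=1$, then $|supp(\gamma)|\geq 10$.
   Context: The support of an element $\alpha=\sum_{x\in G}\alpha_x x$ of $\mathbb{F}[G]$ is $supp(\alpha)=\{x\in G\mid \alpha_x\neq 0\}$. *)

(* Defs.v *)
(* G is a (possibly infinite) groupType of monoid.v; the elements of F[G] are  *)
(* the finitely supported functions {malg F[G]} of monalg.v, with coefficients *)
(* mcoeff x a (a@_x) and support msupp a = {x | a@_x <> 0} (mcoeff_neq0).      *)
From HB Require Import structures.
From mathcomp Require Import all_boot all_algebra.
From mathcomp Require Import finmap.
From mathcomp.multinomials Require Import monalg.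

Set Implicit Arguments.
Unset Strict Implicit.
Unset Printing Implicit Defensive.

Import GRing.Theory.

Local Open Scope fset_scope.
Local Open Scope ring_scope.

Definition torsion_free (G : groupType) : Prop :=
  forall (x : G) (n : nat), (0 < n)%N -> (x ^+ n = 1)%g -> x = 1%g.

(* An alias is needed: the ring structure that monalg.v puts on {malg R[K]}    *)
(* requires K to be a monoid in which x * y = 1 forces x = y = 1, so it is not *)
(* available for groups. Only the F-module structure is reused.                *)
Definition group_algebra (F : fieldType) (G : groupType) : Type := {malg F[G]}.

HB.instance Definition _ (F : fieldType) (G : groupType) :=
  GRing.Lmodule.copy (group_algebra F G) {malg F[G]}.

Section GroupAlgebra.
Context (F : fieldType) (G : groupType).

Implicit Types (a b c : group_algebra F G) (x y : G) (k l : F).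

Definition ga_single k x : group_algebra F G := mkmalgU x k.

Definition ga_one : group_algebra F G := ga_single 1 1%g.

Definition ga_mul a b : group_algebra F G :=
  \sum_(x <- msupp a) \sum_(y <- msupp b)
    ga_single (mcoeff x a * mcoeff y b) (x * y)%g.

Lemma ga_single0 x : ga_single 0 x = 0.
Proof. exact: monalgU0. Qed.

Lemma ga_singleD x k l : ga_single (k + l) x = ga_single k x + ga_single l x.
Proof. exact: monalgUD. Qed.

Lemma ga_coeffD x a b : mcoeff x (a + b) = mcoeff x a + mcoeff x b.
Proof. exact: mcoeffD. Qed.

Lemma ga_coeffZ x k a : mcoeff x (k *: a) = k * mcoeff x a.
Proof. exact: mcoeffZ. Qed.

Lemma ga_coeff_single x y k : mcoeff y (ga_single k x) = k *+ (x == y).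
Proof. exact: mcoeffU. Qed.

Lemma ga_sumE a : a = \sum_(x <- msupp a) ga_single (mcoeff x a) x.
Proof. exact: monalgE. Qed.

Lemma ga_mulwl (d1 d2 : {fset G}) a b : msupp a `<=` d1 -> msupp b `<=` d2 ->
  ga_mul a b = \sum_(x <- d1) \sum_(y <- d2)
    ga_single (mcoeff x a * mcoeff y b) (x * y)%g.
Proof.
move=> le_d1 le_d2; rewrite /ga_mul (big_fset_incl _ le_d1) /=.
  apply/eq_bigr=> x _; apply/big_fset_incl => // y _ /mcoeff_outdom ->.
  by rewrite mulr0 ga_single0.
move=> x _ /mcoeff_outdom ax.
by rewrite big1 => // y _; rewrite ax mul0r ga_single0.
Qed.

Lemma ga_mulDl : left_distributive ga_mul +%R.
Proof.
move=> a b c.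
have le_a : msupp a `<=` msupp a `|` msupp b by rewrite fsubsetUl.
have le_b : msupp b `<=` msupp a `|` msupp b by rewrite fsubsetUr.
rewrite (ga_mulwl le_a (fsubset_refl _)) (ga_mulwl le_b (fsubset_refl _)).
rewrite (ga_mulwl (msuppD_le a b) (fsubset_refl _)).
rewrite -big_split /=; apply/eq_bigr=> x _.
rewrite -big_split /=; apply/eq_bigr=> y _.
by rewrite ga_coeffD mulrDl ga_singleD.
Qed.

Lemma ga_mulDr : right_distributive ga_mul +%R.
Proof.
move=> c a b.
have le_a : msupp a `<=` msupp a `|` msupp b by rewrite fsubsetUl.
have le_b : msupp b `<=` msupp a `|` msupp b by rewrite fsubsetUr.
rewrite (ga_mulwl (fsubset_refl _) le_a) (ga_mulwl (fsubset_refl _) le_b).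
rewrite (ga_mulwl (fsubset_refl _) (msuppD_le a b)).
rewrite -big_split /=; apply/eq_bigr=> x _.
rewrite -big_split /=; apply/eq_bigr=> y _.
by rewrite ga_coeffD mulrDr ga_singleD.
Qed.

Lemma ga_mul0l : left_zero 0 ga_mul.
Proof.
by move=> a; rewrite /ga_mul (_ : msupp 0 = fset0) ?big_seq_fset0 ?msupp0.
Qed.

Lemma ga_mul0r : right_zero 0 ga_mul.
Proof.
move=> a; rewrite /ga_mul big1 // => x _.
by rewrite (_ : msupp 0 = fset0) ?big_seq_fset0 ?msupp0.
Qed.

Lemma ga_mulUU k l x y :
  ga_mul (ga_single k x) (ga_single l y) = ga_single (k * l) (x * y)%g.
Proof.
rewrite (ga_mulwl (d1 := [fset x]) (d2 := [fset y])) ?msuppU_le //.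
by rewrite !big_seq_fset1 !ga_coeff_single !eqxx.
Qed.

Lemma ga_mul_suml (I : Type) (r : seq I) (f : I -> group_algebra F G) b :
  ga_mul (\sum_(i <- r) f i) b = \sum_(i <- r) ga_mul (f i) b.
Proof.
exact: (big_morph (ga_mul^~ b) (fun _ _ => ga_mulDl _ _ _) (ga_mul0l _)).
Qed.

Lemma ga_mul_sumr (I : Type) (r : seq I) (f : I -> group_algebra F G) a :
  ga_mul a (\sum_(i <- r) f i) = \sum_(i <- r) ga_mul a (f i).
Proof.
exact: (big_morph (ga_mul a) (fun _ _ => ga_mulDr _ _ _) (ga_mul0r _)).
Qed.

Lemma ga_mulA : associative ga_mul.
Proof.
have UUg k l x y c : ga_mul (ga_single k x) (ga_mul (ga_single l y) c)
    = ga_mul (ga_mul (ga_single k x) (ga_single l y)) c.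
  rewrite (ga_sumE c) !ga_mul_sumr; apply/eq_bigr=> z _.
  by rewrite !ga_mulUU mulrA mulgA.
have Ugg k x b c : ga_mul (ga_single k x) (ga_mul b c)
    = ga_mul (ga_mul (ga_single k x) b) c.
  rewrite (ga_sumE b) ga_mul_suml !ga_mul_sumr ga_mul_suml.
  by apply/eq_bigr=> y _; rewrite UUg.
move=> a b c; rewrite (ga_sumE a) !ga_mul_suml.
by apply/eq_bigr=> x _; rewrite Ugg.
Qed.

Lemma ga_mul1l : left_id ga_one ga_mul.
Proof.
move=> a; rewrite [in LHS](ga_sumE a) ga_mul_sumr [RHS](ga_sumE a).
by apply/eq_bigr=> x _; rewrite ga_mulUU mul1r mul1g.
Qed.

Lemma ga_mul1r : right_id ga_one ga_mul.
Proof.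
move=> a; rewrite [in LHS](ga_sumE a) ga_mul_suml [RHS](ga_sumE a).
by apply/eq_bigr=> x _; rewrite ga_mulUU mulr1 mulg1.
Qed.

Lemma ga_one_neq0 : ga_one != 0.
Proof.
apply/eqP=> /(congr1 (mcoeff 1%g)); rewrite ga_coeff_single eqxx.
by rewrite [RHS]mcoeff0; apply/eqP; rewrite oner_eq0.
Qed.

HB.instance Definition _ := GRing.Zmodule_isNzRing.Build (group_algebra F G)
  ga_mulA ga_mul1l ga_mul1r ga_mulDl ga_mulDr ga_one_neq0.

Lemma ga_scale_single k l x : k *: ga_single l x = ga_single (k * l) x.
Proof.
by apply/malgP=> y; rewrite ga_coeffZ !ga_coeff_single mulrnAr.
Qed.

Lemma ga_scaleAl k a b : k *: (a * b) = (k *: a) * b.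
Proof.
change (k *: ga_mul a b = ga_mul (k *: a) b).
rewrite (ga_sumE a) (ga_sumE b) ga_mul_suml !scaler_sumr ga_mul_suml.
apply/eq_bigr=> x _; rewrite !ga_mul_sumr scaler_sumr.
by apply/eq_bigr=> y _; rewrite ga_mulUU !ga_scale_single ga_mulUU mulrA.
Qed.

Lemma ga_scaleAr k a b : k *: (a * b) = a * (k *: b).
Proof.
change (k *: ga_mul a b = ga_mul a (k *: b)).
rewrite (ga_sumE a) (ga_sumE b) ga_mul_suml !scaler_sumr ga_mul_suml.
apply/eq_bigr=> x _; rewrite !ga_mul_sumr scaler_sumr.
by apply/eq_bigr=> y _; rewrite ga_mulUU !ga_scale_single ga_mulUU mulrCA.
Qed.

HB.instance Definition _ :=
  GRing.Lmodule_isLalgebra.Build F (group_algebra F G) ga_scaleAl.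
HB.instance Definition _ :=
  GRing.Lalgebra_isAlgebra.Build F (group_algebra F G) ga_scaleAr.

End GroupAlgebra.

(* Main.v *)
(* Let h_0, h_1, h_2 be the support of delta and B that of gamma, and suppose
   that B has at most 9 elements. A product h_i b <> 1 cancels, so it equals
   another product h_j b'; hence at most one pair (b, i) is unmatched. A closed
   chain of k coincidences h_i b = h_j b' gives a relator in x = h_0^-1 h_1 and
   y = h_0^-1 h_2. For k <= 4 there are, up to symmetry, 16 relators. Fourteen of
   them force torsion, or make <x, y> abelian or solvable with a relation
   u v u^-1 = v^n; such a group is left-ordered, and then the largest and the
   smallest products give two unmatched pairs. The other two relators present the
   trefoil group a^2 = b^3; an exhaustive search over the ways to match the
   remaining pairs on at most 9 elements always meets a further relator that, in
   a torsion-free group, makes a and b commute. Without closed chains of length at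
   most 4, the elements within two coincidences of some b in B are 10 in number. *)
Require Import Defs.
From mathcomp Require Import all_boot all_algebra finmap.
From mathcomp.multinomials Require Import monalg.
From mathcomp Require Import zify ring.

(** * Integer powers *)

Section IntegerPowers.
Local Open Scope group_scope.
Context (G : groupType).
Implicit Types (x y : G) (m n : int).

Definition expz x n : G :=
  match n with Posz k => x ^+ k | Negz k => x ^- k.+1 end.

Lemma intS_subS (n : nat) : (- n.+1%:Z + 1 = - n%:Z)%R.
Proof. by rewrite -addn1 PoszD GRing.opprD GRing.addrNK. Qed.

Lemma expzS x n : expz x (n + 1)%R = expz x n * x.
Proof.
case: n => [k|k]; first by rewrite /= addn1 expgSr.
rewrite NegzE intS_subS /= expgS invgM mulgVK.
by case: k => [|k] /=; rewrite ?invg1.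
Qed.

(** The laws for sums, products and morphic images below come from this uniqueness of recursion over
    the integers, with one side of each law taken as [f]. *)
Lemma expz_unique x (f : int -> G) :
  f 0%R = 1 -> (forall n, f (n + 1)%R = f n * x) -> forall n, f n = expz x n.
Proof.
move=> f0 fS; elim/int_rect => [|n IHn|n IHn] //.
  by rewrite -addn1 PoszD fS expzS IHn.
by apply: (mulIg x); rewrite -fS -expzS intS_subS.
Qed.

Lemma expzD x m n : expz x (m + n)%R = expz x m * expz x n.
Proof.
apply: (mulgI (expz x m)^-1); rewrite mulKg.
apply: (expz_unique x (fun n => (expz x m)^-1 * expz x (m + n)%R)).
  by rewrite GRing.addr0 mulVg.
by move=> k; rewrite GRing.addrA expzS mulgA.
Qed.

Lemma expzN x n : expz x (- n)%R = (expz x n)^-1.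
Proof. by apply: (mulIg (expz x n)); rewrite -expzD GRing.addNr mulVg. Qed.

Lemma expz_morph (f : G -> G) : {morph f : x y / x * y} ->
  forall x n, f (expz x n) = expz (f x) n.
Proof.
move=> fM x; apply: (expz_unique (f x) (fun n => f (expz x n))).
  by apply: (mulIg (f 1)); rewrite -fM !mul1g.
by move=> k; rewrite expzS fM.
Qed.

Lemma expz1g n : expz 1 n = 1 :> G.
Proof. by case: n => k /=; rewrite expg1n ?invg1. Qed.

Lemma expzM x m n : expz x (m * n)%R = expz (expz x m) n.
Proof.
apply: (expz_unique _ (fun n => expz x (m * n)%R)); first by rewrite GRing.mulr0.
by move=> k; rewrite GRing.mulrDr GRing.mulr1 expzD.
Qed.

Lemma expzJ x y n : y * expz x n * y^-1 = expz (y * x * y^-1) n.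
Proof.
apply: (expz_morph (fun z => y * z * y^-1)) => z t /=.
by rewrite !mulgA mulgVK.
Qed.

Lemma commute_expz x y n : commute x y -> commute x (expz y n).
Proof.
move=> cxy; apply: (mulIg x^-1); rewrite expzJ cxy mulgK.
by rewrite mulgK.
Qed.

Lemma expzMn x y n : commute x y -> expz (x * y) n = expz x n * expz y n.
Proof.
move=> cxy; apply/esym.
apply: (expz_unique _ (fun n => expz x n * expz y n)); first exact: mulg1.
move=> k; rewrite !expzS -!mulgA; congr (_ * _).
by rewrite !mulgA (commute_expz _ _ k cxy).
Qed.

Lemma expz_eq1 x n : torsion_free G -> expz x n = 1 -> n <> 0%R -> x = 1.
Proof.
move=> tfG; case: n => [[|k]|k] //= xk1 _; apply: (tfG _ k.+1 isT) => //.
by apply: invg_inj; rewrite invg1.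
Qed.

End IntegerPowers.

(** * Configurations and left orders *)

(** With [False] as the goal, one may split on an undecidable [Q] without an axiom. *)
Lemma double_neg_case (Q : Prop) : (Q -> False) -> (~ Q -> False) -> False.
Proof. by move=> qF nqF; apply: nqF => /qF. Qed.

(* [R] and [C] need not be decidable, whence the formulation by contradiction. *)
Lemma finite_maximum (T : eqType) (R : T -> T -> Prop) (C : T -> Prop)
    (x0 : T) (s : seq T) :
  (forall x, ~ R x x) -> (forall x y z, R x y -> R y z -> R x z) -> C x0 ->
  (forall m, m \in x0 :: s -> C m ->
    (forall y, y \in s -> C y -> ~ R m y) -> False) -> False.
Proof.
move=> Rirr Rtr Cx0; elim: s => [|y s IHs] maxF.
  by apply: (maxF x0); rewrite ?mem_head.
apply: IHs => m ms Cm maxm; apply: (@double_neg_case (C y /\ R m y)) => [[Cy Rmy]|nRmy].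
  apply: (maxF y) => //; first by rewrite !inE eqxx orbT.
  move=> z; rewrite inE => /predU1P[->|zs] Cz; first exact: Rirr.
  by move=> /(Rtr _ _ _ Rmy); apply: maxm.
apply: (maxF m) => //.
  by move: ms; rewrite !inE => /orP[->|->]; rewrite ?orbT.
move=> z; rewrite inE => /predU1P[->|zs] Cz; last exact: maxm.
by move=> Rmy; apply: nRmy.
Qed.

Section Configurations.
Local Open Scope group_scope.
Context (G : groupType).
Implicit Types (h : nat -> G) (B : seq G) (b : G) (i j : nat).

Definition unmatched h B b i :=
  [/\ b \in B, (i < 3)%N & forall b' i', b' \in B -> (i' < 3)%N ->
    h i * b = h i' * b' -> b = b' /\ i = i'].

(** The combinatorial residue of [delta * gamma = 1], with [h] listing the support of [delta] and
    [B] that of [gamma]. The coefficients survive only in [conf_unmatched]: a product that occurs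
    once cannot cancel, so it is 1. *)
Record configuration h B : Prop := Configuration {
  conf_inj : forall i j, (i < 3)%N -> (j < 3)%N -> h i = h j -> i = j;
  conf_size : (size B <= 9)%N;
  conf_neq0 : B != [::];
  conf_unmatched : forall b i b' i',
    unmatched h B b i -> unmatched h B b' i' -> b = b' /\ i = i' }.

Lemma unmatched_or_match h B b i : configuration h B -> b \in B -> (i < 3)%N ->
  unmatched h B b i \/ exists b' i',
    [/\ b' \in B, (i' < 3)%N, i' != i, b' != b & h i * b = h i' * b'].
Proof.
move=> Bconf bB i3.
case match_bi: (has (fun b' => has (fun i' => (h i * b == h i' * b') &&
    ((b != b') || (i != i'))) (iota 0 3)) B); last first.
  left; split=> // b' i' b'B i'3 e.
  move/hasPn: (negbT match_bi) => /(_ b' b'B)/hasPn/(_ i').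
  rewrite mem_iota i'3 e eqxx /= negb_or !negbK => /(_ isT).
  by case/andP=> /eqP-> /eqP->.
right; case/hasP: match_bi => b' b'B /hasP[i' i'_in /andP[/eqP e ne]].
have i'3 : (i' < 3)%N by rewrite mem_iota in i'_in.
have ii' : i' != i.
  apply/eqP=> ei; move: ne; rewrite ei eqxx orbF in e *.
  by rewrite (mulgI _ _ _ e) eqxx.
exists b', i'; split=> //; apply: contraNneq ii' => eb; apply/eqP/esym.
by apply: (conf_inj _ _ Bconf) => //; apply: (mulIg b); rewrite e eb.
Qed.

Section LeftOrder.
Variables (h : nat -> G) (B : seq G) (g : G) (t : nat -> G) (H : G -> Prop).
Hypothesis Bconf : configuration h B.
Hypothesis htE : forall i, (i < 3)%N -> h i = g * t i.
Hypothesis Ht : forall i, (i < 3)%N -> H (t i).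
Hypothesis HM : forall x y, H x -> H y -> H (x * y).
Hypothesis HV : forall x, H x -> H x^-1.

(** Cone of the left-invariant order in which [x < y] means [P (x^-1 * y)]; totality is asked on the
    subgroup [H] only. *)
Definition positive_cone (P : G -> Prop) :=
  [/\ forall x y, P x -> P y -> P (x * y), ~ P 1 &
      forall x, H x -> [\/ x = 1, P x | P x^-1]].

(** Only the elements of [B] in the coset [H b0] are compared. Up to the factor [b0^-1], take the
    largest such [m], then [i] with [t i * m] largest. If this product equals [t j * b'], a smaller
    [b'] would make [t j * m] larger still, so [b' = m]. *)
Lemma extreme_unmatched P b0 : positive_cone P -> b0 \in B ->
  (forall b i, unmatched h B b i -> H (b * b0^-1) ->
    (forall j, (j < 3)%N ->
      ~ P ((t i * (b * b0^-1))^-1 * (t j * (b * b0^-1)))) -> False) -> False.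
Proof.
move=> [PM P1 Ptot] b0B contra.
have Rirr x : ~ P (x^-1 * x) by rewrite mulVg.
have Rtr x y z : P (x^-1 * y) -> P (y^-1 * z) -> P (x^-1 * z).
  by move=> Pxy /(PM _ _ Pxy); rewrite -mulgA mulVKg.
have Hb0 : H (b0 * b0^-1).
  by rewrite mulgV -(mulVg (t 0)); apply: HM; [apply: HV|]; apply: Ht.
apply: (@finite_maximum G (fun b b' => P ((b * b0^-1)^-1 * (b' * b0^-1)))
          (fun b => H (b * b0^-1)) b0 B) => // [x y z|m]; first exact: Rtr.
rewrite inE => m_in Hm maxm.
have mB : m \in B by case/predU1P: m_in => [->|].
apply: (@finite_maximum nat
          (fun i j => P ((t i * (m * b0^-1))^-1 * (t j * (m * b0^-1))))
          (fun i => i < 3)%N 0 (iota 0 3)) => // [x y z|i _ i3 maxi].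
  exact: Rtr.
apply: (contra m i) => [|//|j j3]; last by apply: maxi; rewrite ?mem_iota.
split=> // b' j b'B j3 hij.
have tij : t i * (m * b0^-1) = t j * (b' * b0^-1).
  by rewrite !mulgA; congr (_ * _); apply: (mulgI g); rewrite !mulgA -!htE.
have Hb' : H (b' * b0^-1).
  rewrite -(mulKg (t j) (b' * _)) -tij; apply: HM; first by apply/HV/Ht.
  by apply: HM => //; apply: Ht.
case: (Ptot _ (HM _ _ (HV _ Hm) Hb')) => [eq1|Pmb|Pbm].
- have mb' : m = b'.
    by apply/(mulIg b0^-1)/(mulgI (m * b0^-1)^-1); rewrite eq1 mulVg.
  split=> //; apply: (conf_inj _ _ Bconf) => //.
  by apply: (mulIg m); rewrite hij mb'.
- by case: (maxm _ b'B Hb').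
case: (maxi j) => //; first by rewrite mem_iota.
by move: Pbm; rewrite tij !invgM !invgK !mulgA mulgVK.
Qed.

(** The cone and its inverse yield a largest and a smallest product, both unmatched. Their pairs
    coincide by uniqueness, so all the [t j] agree, against the injectivity of [h]. *)
Lemma left_ordered_contradiction P : positive_cone P -> False.
Proof.
move=> Pcone; have [PM P1 Ptot] := Pcone.
have [b0 b0B] : exists b, b \in B.
  by case: B (conf_neq0 _ _ Bconf) => // b s _; exists b; rewrite mem_head.
have Pcone' : positive_cone (fun x => P x^-1).
  split=> [x y Px Py||x Hx]; first by rewrite invgM; apply: PM.
  - by rewrite invg1.
  - by rewrite invgK; case: (Ptot x Hx) => ?; constructor.
apply: (extreme_unmatched _ _ Pcone b0B) => b i unm Hb maxi.
apply: (extreme_unmatched _ _ Pcone' b0B) => b' i' unm' _ mini.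
have [eb ei] := conf_unmatched _ _ Bconf _ _ _ _ unm unm'; subst b' i'.
have [_ i3 _] := unm.
have tE j : (j < 3)%N -> j = i.
  move=> j3; have Htb k : (k < 3)%N -> H (t k * (b * b0^-1)).
    by move=> k3; apply: HM => //; apply: Ht.
  case: (Ptot _ (HM _ _ (HV _ (Htb i i3)) (Htb j j3))) => [eq1|Pij|Pji].
  - apply: (conf_inj _ _ Bconf) => //; rewrite !htE //; congr (_ * _).
    by apply/(mulIg (b * b0^-1))/(mulgI (t i * (b * b0^-1))^-1); rewrite eq1 mulVg.
  - by case: (maxi j j3).
  by case: (mini j j3).
by have := tE 0 isT; rewrite -(tE 1%N isT).
Qed.

End LeftOrder.
End Configurations.

(** * Left orders on abelian groups and on groups with a relation [u v u^-1 = v^n] *)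

Section OrderedGroups.
Local Open Scope group_scope.
Context (G : groupType) (tfG : torsion_free G).
Variables (h : nat -> G) (B : seq G) (g : G) (t : nat -> G).
Hypothesis Bconf : configuration _ h B.
Hypothesis htE : forall i, (i < 3)%N -> h i = g * t i.

Lemma commuting_contradiction u v : commute u v ->
  (forall i, (i < 3)%N -> exists p q, t i = expz _ u p * expz _ v q) -> False.
Proof.
move=> cuv tE; pose E p q := expz _ u p * expz _ v q.
have ED p q p' q' : E p q * E p' q' = E (p + p')%R (q + q')%R.
  rewrite /E !expzD -!mulgA; congr (_ * _); rewrite !mulgA; congr (_ * _).
  by apply/commute_expz/commute_sym/commute_expz.
have E0 : E 0%R 0%R = 1 by rewrite /E mulg1.
have EV p q : (E p q)^-1 = E (- p)%R (- q)%R.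
  by apply: (mulgI (E p q)); rewrite mulgV ED !GRing.addrN E0.
have EX p q n : expz _ (E p q) n = E (p * n)%R (q * n)%R.
  rewrite /E expzMn ?expzM //.
  by apply/commute_expz/commute_sym/commute_expz.
pose H x := exists p q, x = E p q.
have HM x y : H x -> H y -> H (x * y).
  by move=> [p [q ->]] [p' [q' ->]]; exists (p + p')%R, (q + q')%R; rewrite ED.
have HV x : H x -> H x^-1.
  by move=> [p [q ->]]; exists (- p)%R, (- q)%R; rewrite EV.
have contra := left_ordered_contradiction G h B g t H Bconf htE tE HM HV.
(* If E s r = 1 with (s, r) <> (0, 0), then p r - q s determines E p q, and it
   orders the group; otherwise the group is free abelian on u and v and is
   ordered lexicographically. *)
apply: (@double_neg_case (exists s r, E s r = 1 /\ (s, r) <> (0%R, 0%R))).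
  case=> s [r [Esr nz]].
  apply: (contra (fun x => exists p q, x = E p q /\ (0 < p * r - q * s)%R)).
  split=> [x y [p [q [-> lt1]]] [p' [q' [-> lt2]]]|[p [q [E1 lt0]]]|x [p [q ->]]].
  - by exists (p + p')%R, (q + q')%R; rewrite ED; split=> //; lia.
  (* Cramer's rule: [E p q = 1] and [E s r = 1] kill the powers of [u] and [v] with exponent the
     nonzero determinant, so [u = v = 1] and the [h i] coincide. *)
  - have uv1 a b : E a b = 1 -> forall n, expz _ (E a b) n = 1.
      by move=> -> n; rewrite expz1g.
    have := uv1 _ _ (esym E1) r; have := uv1 _ _ Esr (- q)%R.
    have := uv1 _ _ (esym E1) (- s)%R; have := uv1 _ _ Esr p.
    rewrite !EX => e1 e2 e3 e4.
    have u1 : u = 1.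
      apply: (expz_eq1 _ u (p * r - q * s)%R) => //; last by lia.
      have := ED (p * r)%R (q * r)%R (s * - q)%R (r * - q)%R.
      rewrite e3 e4 mulg1 => e; rewrite {}e /E.
      have -> : (q * r + r * - q = 0)%R by ring.
      by rewrite mulg1; congr expz; ring.
    have v1 : v = 1.
      apply: (expz_eq1 _ v (p * r - q * s)%R) => //; last by lia.
      have := ED (p * - s)%R (q * - s)%R (s * p)%R (r * p)%R.
      rewrite e1 e2 mulg1 => e; rewrite {}e /E.
      have -> : (p * - s + s * p = 0)%R by ring.
      by rewrite mul1g; congr expz; ring.
    have t1 i : (i < 3)%N -> t i = 1.
      by case/tE=> a [b ->]; rewrite u1 v1 !expz1g mulg1.
    by have := conf_inj _ _ _ Bconf 0 1%N isT isT; rewrite !htE // !t1 // => /(_ erefl).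
  have [lt0|[gt0|eq0]] : (p * r - q * s < 0 \/ 0 < p * r - q * s \/
      p * r - q * s = 0)%R by lia.
  - by constructor 3; exists (- p)%R, (- q)%R; rewrite EV; split=> //; lia.
  - by constructor 2; exists p, q.
  (* With determinant 0, [(p, q)] is proportional to [(s, r)], so a nonzero power of [E p q] is a
     power of [E s r = 1]. *)
  constructor 1; have [r0|/eqP r0] := eqVneq r 0%R; last first.
    apply: (expz_eq1 _ _ r) => //; rewrite EX.
    have -> : (p * r = s * q)%R by lia.
    by rewrite (GRing.mulrC q) -EX Esr expz1g.
  apply: (expz_eq1 _ _ s) => //; last by move=> s0; apply: nz; rewrite s0 r0.
  rewrite EX; have -> : (q * s = r * p)%R by lia.
  by rewrite (GRing.mulrC p) -EX Esr expz1g.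
move=> indep.
apply: (contra (fun x => exists p q, x = E p q /\ (0 < p \/ p = 0 /\ 0 < q)%R)).
split=> [x y [p [q [-> lt1]]] [p' [q' [-> lt2]]]|[p [q [E1 lt0]]]|x [p [q ->]]].
- by exists (p + p')%R, (q + q')%R; rewrite ED; split=> //; lia.
- by apply: indep; exists p, q; split=> // -[p0 q0]; lia.
have [lt0|[gt0|p0]] : (p < 0 \/ 0 < p \/ p = 0)%R by lia.
- by constructor 3; exists (- p)%R, (- q)%R; rewrite EV; split=> //; lia.
- by constructor 2; exists p, q; split=> //; left.
have [lt0|[gt0|q0]] : (q < 0 \/ 0 < q \/ q = 0)%R by lia.
- by constructor 3; exists (- p)%R, (- q)%R; rewrite EV; split=> //; lia.
- by constructor 2; exists p, q; split=> //; right.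
by constructor 1; rewrite p0 q0.
Qed.


(** The elements [u^-p v^q u^r] form a subgroup. Its order looks first at the sign of [r - p] and
    then, for [p = r], at the sign of [q / n^p], which is that of the integer [n^p q]. *)
Lemma solvable_contradiction u v (n : int) : n <> 0%R -> n <> 1%R ->
  u * v * u^-1 = expz _ v n ->
  (forall i, (i < 3)%N -> exists p q r, t i = u ^- p * expz _ v q * u ^+ r) ->
  False.
Proof.
move=> n0 n1 uv tE.
have [v1|v1] := eqVneq v 1.
  apply: (commuting_contradiction u v); first by rewrite v1; apply: commute1.
  move=> i /tE[p [q [r ->]]]; exists (- p%:Z + r%:Z)%R, 0%R.
  by rewrite v1 expz1g !mulg1 expzD expzN.
have vX m q : expz _ v m = 1 -> m != 0%R -> q.
  by move=> vm /eqP m0; case/eqP: v1; apply: expz_eq1 vm m0.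
pose E p q r := u ^- p * expz _ v q * u ^+ r.
have uXv r q : u ^+ r * expz _ v q = expz _ v (n ^+ r * q)%R * u ^+ r.
  apply: (mulIg (u ^- r)); rewrite mulgK expzJ expzM; congr expz.
  elim: r => [|r IHr]; first by rewrite invg1 mulg1 mul1g.
  have -> : u ^+ r.+1 * v * u ^- r.+1 = u * (u ^+ r * v * u ^- r) * u^-1.
    by rewrite expgS invgM !mulgA.
  by rewrite IHr expzJ uv -expzM -GRing.exprS.
(* Enlarging both outer exponents makes the inner exponents of two factors agree, after which
   [Ecomp] multiplies them. *)
have Eshift m p q r : E p q r = E (p + m)%N (n ^+ m * q)%R (r + m)%N.
  rewrite /E (addnC r m) (addnC p m) !expgnDr invgM -!mulgA.
  by rewrite (mulgA (expz _ v (n ^+ m * q)%R)) -uXv -!mulgA mulKg.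
have Ecomp p q r q' r' : E p q r * E r q' r' = E p (q + q')%R r'.
  by rewrite /E expzD -!mulgA mulVKg.
have EV p q r : (E p q r)^-1 = E r (- q)%R p.
  by rewrite /E !invgM invgK expzN mulgA.
pose H x := exists p q r, x = E p q r.
have HM x y : H x -> H y -> H (x * y).
  move=> [p [q [r ->]]] [p' [q' [r' ->]]].
  rewrite (Eshift p' p) (Eshift r p') (addnC p' r) Ecomp.
  do 3!eexists; reflexivity.
have HV x : H x -> H x^-1.
  by move=> [p [q [r ->]]]; exists r, (- q)%R, p; rewrite EV.
(* The sign of n^p q is unchanged when u^-p v^q u^p is rewritten with a larger p. *)
apply: (left_ordered_contradiction G h B g t H Bconf htE tE HM HV
  (fun x => exists p q r, x = E p q r /\
     ((p < r)%N \/ p = r /\ (0 < n ^+ p * q)%R))).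
have shift_gt0 m p q : (0 < n ^+ p * q)%R -> (0 < n ^+ (p + m) * (n ^+ m * q))%R.
  move=> lt0; have -> : (n ^+ (p + m) * (n ^+ m * q) = (n ^+ m) ^+ 2 * (n ^+ p * q))%R.
    by rewrite GRing.exprD; ring.
  apply: Num.Theory.mulr_gt0 => //; rewrite Num.Theory.exprn_even_gt0 //=.
  by rewrite GRing.expf_neq0 //; apply/eqP.
split=> [x y [p [q [r [-> pr]]]] [p' [q' [r' [-> pr']]]]|[p [q [r [E1 pr]]]]|x [p [q [r ->]]]].
- rewrite (Eshift p' p) (Eshift r p') (addnC p' r) Ecomp.
  do 3!eexists; split; first reflexivity.
  have [pr0|[/eqP pr0 lt0]] := pr; first by left; lia.
  have [pr'0|[pr'0 lt0']] := pr'; first by left; lia.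
  right; subst; split; first by lia.
  rewrite GRing.mulrDr; apply: Num.Theory.addr_gt0; first exact: shift_gt0.
  by rewrite (eqP pr0) addnC; apply: shift_gt0.
- case: pr => [lt_pr|[eq_pr lt0]]; last first.
    have vq1 : expz _ v q = 1.
      apply: (mulgI (u ^- p)); apply: (mulIg (u ^+ p)).
      by rewrite mulg1 mulVg E1 -eq_pr.
    by apply: (vX q) => //; apply: contraTneq lt0 => ->; rewrite GRing.mulr0.
  (* Here [u^d] is a power of [v], so it commutes with [v] and [n^d = 1], whence [n = -1]. Then [u]
     both inverts and fixes [u^d = v^-q], which forces [q = 0], [u = 1] and finally [v = v^-1]. *)
  have [d d_gt0 rE] : exists2 d, (0 < d)%N & r = (d + p)%N.
    by exists (r - p)%N; [lia|rewrite subnK // ltnW].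
  have vud : expz _ v q * u ^+ d = 1.
    apply: (mulgI (u ^- p)); apply: (mulIg (u ^+ p)).
    by rewrite mulg1 mulVg -!mulgA -expgnDr -rE mulgA.
  have ud : u ^+ d = expz _ v (- q)%R.
    by rewrite expzN; apply: (mulgI (expz _ v q)); rewrite vud mulgV.
  have vnd : expz _ v (n ^+ d - 1)%R = 1.
    have := uXv d 1%R; rewrite GRing.mulr1 ud -!expzD => e.
    have -> : (n ^+ d - 1 = n ^+ d - q + (q - 1))%R by ring.
    by rewrite expzD -e -expzD; have -> : (- q + 1 + (q - 1) = 0)%R by ring.
  have [nd1|nd1] := eqVneq (n ^+ d)%R 1%R; last first.
    by apply: (vX _ _ vnd); rewrite GRing.subr_eq0.
  have nN1 : n = (-1)%R.
    have : (`|n| ^ d)%N = 1%N by rewrite -abszX nd1.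
    by move/eqP; rewrite -(exp1n d) eqn_exp2r //; lia.
  have vq : expz _ v (n * - q + q)%R = 1.
    have := uXv 1%N (- q)%R; rewrite -{1}ud GRing.expr1 expg1 -expgS expgSr.
    by move=> /(mulIg u) e; rewrite expzD -e ud -expzD GRing.addNr.
  have [q0|q0] := eqVneq q 0%R; last by apply: (vX _ _ vq); lia.
  have u1 : u = 1 by apply: (tfG u d) => //; rewrite ud q0.
  apply: (vX (n - 1)%R); last by lia.
  by rewrite expzD expzN -uv u1 mul1g invg1 mulg1 /= mulgV.
have [pr|rp|pr] := ltngtP p r.
- by constructor 2; exists p, q, r; split; [|left].
- by constructor 3; exists r, (- q)%R, p; rewrite EV; split; [|left].
rewrite -pr.
have [lt0|[gt0|eq0]] : (n ^+ p * q < 0 \/ 0 < n ^+ p * q \/ n ^+ p * q = 0)%R by lia.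
- constructor 3; exists p, (- q)%R, p; rewrite EV; split=> //; right.
  by split=> //; rewrite GRing.mulrN; lia.
- by constructor 2; exists p, q, p; split=> //; right.
constructor 1; have -> : q = 0%R.
  by move/eqP: eq0; rewrite GRing.mulf_eq0 GRing.expf_eq0 (negPf (introN eqP n0)) andbF => /eqP.
by rewrite /E mulg1 mulVg.
Qed.

End OrderedGroups.

(** * Closed walks and short relators *)

(* The step (i, j) leads from b to b' when h_i b = h_j b'. *)
Definition step : Type := (nat * nat)%type.
Definition word : Type := seq step.
Definition colours : seq nat := [:: 0; 1; 2]%N.
Definition steps : word := [:: (0, 1); (0, 2); (1, 0); (1, 2); (2, 0); (2, 1)]%N.

Definition coloured (w : word) : bool :=
  all (fun s => (s.1 < 3) && (s.2 < 3))%N w.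

Definition swap (s : step) : step := (s.2, s.1).
Definition reverse (w : word) : word := rev (map swap w).

Definition recolourings : seq (seq nat) :=
  [:: [:: 0; 1; 2]; [:: 0; 2; 1]; [:: 1; 0; 2];
      [:: 1; 2; 0]; [:: 2; 0; 1]; [:: 2; 1; 0]]%N.
Definition recolour (p : seq nat) (w : word) : word :=
  [seq (nth 0 p s.1, nth 0 p s.2)%N | s <- w].

Definition rotations (w : word) : seq word := [seq rot k w | k <- iota 0 (size w)].
(** Renaming the [h i], reversing a walk and moving its base point preserve exclusion, so one
    relator per orbit is enough. *)
Definition orbit (w : word) : seq word :=
  flatten [seq rotations (recolour p w) ++ rotations (reverse (recolour p w))
          | p <- recolourings].

Section Walks.
Local Open Scope group_scope.
Context (G : groupType) (tfG : torsion_free G).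
Implicit Types (h t : nat -> G) (B : seq G) (b : G) (w : word).

Fixpoint walk h B b w b' : Prop :=
  if w is s :: w' then
    exists b1, [/\ b1 \in B, h s.1 * b = h s.2 * b1 & walk h B b1 w' b']
  else b = b'.

Definition closed_walk h B w := exists2 b, b \in B & walk h B b w b.

Definition excluded w :=
  forall h B, configuration G h B -> ~ closed_walk h B w.

Lemma walk_cat h B b w1 w2 b' :
  b \in B -> walk h B b (w1 ++ w2) b' <->
  exists b1, [/\ b1 \in B, walk h B b w1 b1 & walk h B b1 w2 b'].
Proof.
elim: w1 b => [|s w1 IHw] b bB /=.
  by split=> [w2b|[b1 [_ -> //]]]; exists b.
split=> [[b1 [b1B hb /(IHw _ b1B)[b2 [b2B w1b w2b]]]]|].
  by exists b2; split=> //; exists b1.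
by move=> [b2 [b2B [b1 [b1B hb w1b] w2b]]]; exists b1; split=> //; apply/IHw => //; exists b2.
Qed.

Lemma excluded_rot w k : excluded w -> excluded (rot k w).
Proof.
move=> exw h B Bconf [b bB].
rewrite /rot => /(walk_cat _ _ _ _ _ _ bB)[b1 [b1B w1 w2]].
apply: (exw h B Bconf); exists b1 => //.
by rewrite -(cat_take_drop k w); apply/walk_cat => //; exists b.
Qed.

Lemma walk_mem h B b w b' : b \in B -> walk h B b w b' -> b' \in B.
Proof. by elim: w b => [|s w IHw] b bB /= => [<-//|[b1 [b1B _ /IHw->]]]. Qed.

Lemma walk_reverse h B b w b' :
  b \in B -> walk h B b w b' -> walk h B b' (reverse w) b.
Proof.
rewrite /reverse; elim: w b => [|s w IHw] b bB /=; first by move->.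
move=> [b1 [b1B hb wb']]; rewrite rev_cons -cats1.
apply/walk_cat; first exact: walk_mem wb'.
by exists b1; split=> //; [apply: IHw | exists b].
Qed.

Lemma excluded_reverse w : excluded w -> excluded (reverse w).
Proof.
move=> exw h B Bconf [b bB /(walk_reverse _ _ _ _ _ bB) wb].
apply: (exw h B Bconf); exists b => //; move: wb.
rewrite /reverse map_rev revK -map_comp (_ : map _ w = w) //.
by rewrite -[RHS]map_id; apply: eq_map => -[].
Qed.

Lemma walk_recolour h B p b w b' :
  walk h B b (recolour p w) b' -> walk (fun i => h (nth 0%N p i)) B b w b'.
Proof.
elim: w b => [//|s w IHw] b /= [b1 [b1B hb wb]].
by exists b1; split=> //; apply: IHw.
Qed.

Lemma configuration_recolour h B p : p \in recolourings ->
  configuration G h B -> configuration G (fun i => h (nth 0%N p i)) B.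
Proof.
move=> p_in [h_inj sizeB B0 unmB].
have [p3 p_inj p_surj] : [/\ forall i, (i < 3)%N -> (nth 0%N p i < 3)%N,
    forall i j, (i < 3)%N -> (j < 3)%N -> nth 0%N p i = nth 0%N p j -> i = j &
    forall j, (j < 3)%N -> exists2 i, (i < 3)%N & nth 0%N p i = j].
  have := p_in; rewrite !inE.
  do 5?[case/predU1P=> [->|]]; last move/eqP->;
    by split=> [[|[|[]]]|[|[|[]]] // [|[|[]]]|[|[|[]]]] // _;
      (by exists 0%N) || (by exists 1%N) || (by exists 2).
have unm_p b i : unmatched G (fun i => h (nth 0%N p i)) B b i ->
    unmatched G h B b (nth 0%N p i).
  move=> [bB i3 unm]; split=> //; first exact: p3.
  by move=> b' _ b'B /p_surj[i' i'3 <-] /(unm b' i' b'B i'3)[-> ->].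
split=> // [i j i3 j3 /h_inj e|b i b' i' unm unm'].
  by apply: p_inj => //; apply: e; apply: p3.
have [-> e] := unmB _ _ _ _ (unm_p _ _ unm) (unm_p _ _ unm').
by split=> //; apply: p_inj => //; [case: unm | case: unm'].
Qed.

Lemma excluded_recolour p w :
  p \in recolourings -> excluded w -> excluded (recolour p w).
Proof.
move=> p_in exw h B Bconf [b bB /walk_recolour wb].
apply: (exw _ B (configuration_recolour _ _ _ p_in Bconf)).
by exists b.
Qed.

Lemma excluded_orbit w w' : excluded w -> w' \in orbit w -> excluded w'.
Proof.
move=> exw /flatten_mapP[p p_in]; rewrite mem_cat.
have exp := excluded_recolour p w p_in exw.
by case/orP=> /mapP[k _ ->]; apply: excluded_rot => //; apply: excluded_reverse.
Qed.

(** The common left factor [g] of the [h i] cancels in each [h_j^-1 h_i], so a closed walk is a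
    relator in the [t i]. *)
Fixpoint walk_value t w : G :=
  if w is s :: w' then walk_value t w' * ((t s.2)^-1 * t s.1) else 1.

Lemma walk_valueE h t g B b w b' : (forall i, (i < 3)%N -> h i = g * t i) ->
  coloured w ->
  walk h B b w b' -> b' = walk_value t w * b.
Proof.
move=> htE; elim: w b => [|s w IHw] b /=; first by rewrite mul1g.
move=> /andP[/andP[s1 s2] w3] [b1 [b1B hb /(IHw _ w3)->]].
rewrite -mulgA; congr (_ * _); apply: (mulgI (h s.2)).
by rewrite -hb !htE // !mulgA mulgK.
Qed.

Definition quotients h : seq G := [:: 1; (h 0%N)^-1 * h 1%N; (h 0%N)^-1 * h 2].

Lemma quotientsE h i : (i < 3)%N -> h i = h 0%N * nth 1 (quotients h) i.
Proof. by case: i => [|[|[|]]] //= _; rewrite ?mulg1 ?mulVKg. Qed.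

Lemma closed_walk_value h B w : coloured w -> closed_walk h B w ->
  walk_value (nth 1 (quotients h)) w = 1.
Proof.
move=> w3 [b _ /(walk_valueE _ _ _ _ _ _ _ (quotientsE h) w3) wb].
by apply: (mulIg b); rewrite mul1g -wb.
Qed.

Lemma excluded_relation w : coloured w ->
  (forall h B (x y : G), configuration G h B ->
    (forall i, (i < 3)%N -> h i = h 0%N * nth 1 [:: 1; x; y] i) ->
    x <> 1 -> walk_value (nth 1 [:: 1; x; y]) w = 1 -> False) -> excluded w.
Proof.
move=> w3 contra h B Bconf /(closed_walk_value _ _ _ w3).
apply: (contra h B _ _ Bconf (quotientsE h)) => x1.
have /(conf_inj _ _ _ Bconf 1%N 0%N isT isT) // : h 1%N = h 0%N.
by rewrite (quotientsE h 1%N) //= x1 mulg1.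
Qed.

Lemma commuting_relation h B (x y : G) : configuration G h B ->
  (forall i, (i < 3)%N -> h i = h 0%N * nth 1 [:: 1; x; y] i) ->
  commute x y -> False.
Proof.
move=> Bconf htE cxy; apply: (commuting_contradiction G tfG h B _ _ Bconf htE x y cxy).
move=> [|[|[]]] //= _; [exists 0%R, 0%R|exists 1%R, 0%R|exists 0%R, 1%R];
  by rewrite ?mulg1 ?mul1g.
Qed.

Lemma solvable_relation h B (x y u v : G) (n : int) : configuration G h B ->
  (forall i, (i < 3)%N -> h i = h 0%N * nth 1 [:: 1; x; y] i) ->
  n <> 0%R -> n <> 1%R -> u * v = expz _ v n * u ->
  (exists p q r, x = u ^- p * expz _ v q * u ^+ r) ->
  (exists p q r, y = u ^- p * expz _ v q * u ^+ r) -> False.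
Proof.
move=> Bconf htE n0 n1 uv xE yE.
apply: (solvable_contradiction G tfG h B _ _ Bconf htE u v n) => //.
  by rewrite uv mulgK.
by move=> [|[|[]]] //= _; exists 0%N, 0%R, 0%N; rewrite /= invg1 !mulg1.
Qed.

(* The lemmas below are named after the relator, X and Y being the inverses of x
   and y; later steps multiply on the left, so a relator reads backwards. *)
Local Ltac relation :=
  apply: excluded_relation => // h B x y Bconf htE x1 /=;
  rewrite ?invg1 ?mul1g ?mulg1 => E.

Lemma excluded_x2 : excluded [:: (1, 0); (1, 0)]%N.
Proof. by relation; apply/x1/(tfG x 2). Qed.

Lemma excluded_x3 : excluded [:: (1, 0); (1, 0); (1, 0)]%N.
Proof. by relation; apply/x1/(tfG x 3) => //; rewrite !expgS mulg1 mulgA. Qed.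

Lemma excluded_x4 : excluded [:: (1, 0); (1, 0); (1, 0); (1, 0)]%N.
Proof. by relation; apply/x1/(tfG x 4) => //; rewrite !expgS mulg1 !mulgA. Qed.

Lemma commute_of_expgM (x y : G) n : x ^+ n * y = 1 -> commute x y.
Proof.
by move=> /mulg1_eq<-; apply: commuteV; apply: commuteX; apply: commute_refl.
Qed.

Lemma excluded_xy : excluded [:: (2, 0); (1, 0)]%N.
Proof.
relation; apply: (commuting_relation _ _ _ _ Bconf htE).
exact: (commute_of_expgM x y 1).
Qed.

Lemma excluded_xxy : excluded [:: (2, 0); (1, 0); (1, 0)]%N.
Proof.
relation; apply: (commuting_relation _ _ _ _ Bconf htE).
exact: (commute_of_expgM x y 2).
Qed.

Lemma excluded_xxxy : excluded [:: (2, 0); (1, 0); (1, 0); (1, 0)]%N.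
Proof.
relation; apply: (commuting_relation _ _ _ _ Bconf htE).
by apply: (commute_of_expgM x y 3); rewrite -E !expgS mulg1 !mulgA.
Qed.

(** Reduces each use of a relator to an identity of free groups, once the conjugator [c] is
    supplied. *)
Lemma eq_of_relator (w c a b : G) : w = 1 -> a / b = c * w * c^-1 -> a = b.
Proof. by move=> ->; rewrite mulg1 mulgV => /divg1_eq. Qed.

Lemma excluded_commutator : excluded [:: (1, 0); (2, 1); (0, 2)]%N.
Proof.
relation; apply: (commuting_relation _ _ _ _ Bconf htE).
by apply/esym/(eq_of_relator _ (x * y) _ _ E); rewrite !gnorm.
Qed.

Lemma excluded_xyxy : excluded [:: (2, 0); (1, 0); (2, 0); (1, 0)]%N.
Proof.
relation; apply: (commuting_relation _ _ _ _ Bconf htE).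
apply: (commute_of_expgM x y 1); apply: (tfG _ 2) => //.
by rewrite -E expg2 !mulgA.
Qed.

Lemma excluded_Yxyx : excluded [:: (1, 0); (2, 0); (1, 2)]%N.
Proof.
relation; apply: (solvable_relation _ _ _ _ y^-1 x (-1) Bconf htE) => //=.
- by apply: (eq_of_relator _ 1 _ _ E); rewrite !gnorm.
- by exists 0%N, 1%R, 0%N; rewrite /= !gnorm.
- by exists 1%N, 0%R, 0%N; rewrite /= !gnorm.
Qed.

Lemma excluded_Yxyxx : excluded [:: (1, 0); (1, 0); (2, 0); (1, 2)]%N.
Proof.
relation; apply: (solvable_relation _ _ _ _ y^-1 x (-2) Bconf htE) => //=.
- by apply: (eq_of_relator _ 1 _ _ E); rewrite expg2 !gnorm.
- by exists 0%N, 1%R, 0%N; rewrite /= !gnorm.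
- by exists 1%N, 0%R, 0%N; rewrite /= !gnorm.
Qed.

Lemma excluded_YXyxx : excluded [:: (1, 0); (1, 0); (2, 1); (0, 2)]%N.
Proof.
relation; apply: (solvable_relation _ _ _ _ y^-1 x 2 Bconf htE) => //=.
- by apply/esym/(eq_of_relator _ (x * x) _ _ E); rewrite expg2 !gnorm.
- by exists 0%N, 1%R, 0%N; rewrite /= !gnorm.
- by exists 1%N, 0%R, 0%N; rewrite /= !gnorm.
Qed.

Lemma excluded_Yxxyx : excluded [:: (1, 0); (2, 0); (1, 0); (1, 2)]%N.
Proof.
relation; apply: (solvable_relation _ _ _ _ y x (-2) Bconf htE) => //=.
- by apply: (eq_of_relator _ (y^-1 * x * x)^-1 _ _ E); rewrite expg2 !gnorm.
- by exists 0%N, 1%R, 0%N; rewrite /= !gnorm.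
- by exists 0%N, 0%R, 1%N; rewrite /= !gnorm.
Qed.

Lemma excluded_YXyyx : excluded [:: (1, 0); (2, 0); (2, 1); (0, 2)]%N.
Proof.
relation; apply: (solvable_relation _ _ _ _ x y 2 Bconf htE) => //=.
- by apply/esym/(eq_of_relator _ (y^-1 * x^-1)^-1 _ _ E); rewrite expg2 !gnorm.
- by exists 0%N, 0%R, 1%N; rewrite /= !gnorm.
- by exists 0%N, 1%R, 0%N; rewrite /= !gnorm.
Qed.

(** This is the Klein bottle relator: for [v = x y] it reads [x^-1 v x = v^-1], and then
    [y = v^-1 x^-1]. *)
Lemma excluded_xxyy : excluded [:: (2, 0); (2, 0); (1, 0); (1, 0)]%N.
Proof.
relation; apply: (solvable_relation _ _ _ _ x^-1 (x * y) (-1) Bconf htE) => //=.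
- by apply: (eq_of_relator _ (x * x * y)^-1 _ _ E); rewrite !gnorm.
- by exists 1%N, 0%R, 0%N; rewrite /= !gnorm.
- exists 0%N, (-1)%R, 1%N.
  by apply: (eq_of_relator _ (x * x * y)^-1 _ _ E); rewrite /= !gnorm.
Qed.
End Walks.

(** * The trefoil group *)

(* In the group <a, b | a^2 = b^3>, whose centre is generated by c = a^2, the
   triple (p, q, s) stands for c^(p - q) times the product of the letters of s:
   0 is a, 1 is b and 2 is b^-1. *)
Definition trefoil : Type := (nat * nat * seq nat)%type.

(** Left multiplication by a letter, reduced with [a a = c], [b b = c b^-1] and
    [b^-1 b^-1 = c^-1 b]. Powers of [a] and of [b] alternate in the result if they do in the
    argument. *)
Definition push (l : nat) (e : trefoil) : trefoil :=
  let: (p, q, s) := e in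
  if s is l' :: s' then
    match l, l' with
    | 0, 0 => (p.+1, q, s')
    | 1, 1 => (p.+1, q, 2 :: s')
    | 2, 2 => (p, q.+1, 1%N :: s')
    | 1, 2 | 2, 1 => (p, q, s')
    | _, _ => (p, q, l :: s)
    end
  else (p, q, [:: l]).

Definition push_inverse (l : nat) (e : trefoil) : trefoil :=
  match l with
  | 0 => let: (p, q, s) := push 0 e in (p, q.+1, s)
  | 1 => push 2 e
  | _ => push 1 e
  end.

(* The word [xs] is the value of h_0^-1 h_1, while h_0^-1 h_2 is always b. *)
Definition trefoil_letters (xs : seq nat) (i : nat) : seq nat :=
  nth [::] [:: [::]; xs; [:: 1%N]] i.

Fixpoint trefoil_value (xs : seq nat) (w : word) (e : trefoil) : trefoil :=
  if w is s :: w' then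
    trefoil_value xs w'
      (foldl (fun e l => push_inverse l e)
        (foldr push e (trefoil_letters xs s.1)) (trefoil_letters xs s.2))
  else e.

(** Conjugates by the last letter, which may cancel against the first. *)
Definition rotate_trefoil (e : trefoil) : trefoil :=
  let: (p, q, s) := e in
  if s is l :: s' then push (last l s') (p, q, belast l s') else e.

(* These elements are c^m times 1, a, b, b^-1, ab, ab^-1, (ab)^2, (ab^-1)^2 or
   [a, b]: killing one of them in a torsion-free group makes a and b commute. *)
Definition collapsing (e : trefoil) : bool :=
  let: (p, q, s) := e in
  if s is [::] then p != q else
  if (4 < size s)%N then false else
  s \in [:: [:: 0]; [:: 1]; [:: 2]; [:: 0; 1]; [:: 0; 2];
            [:: 0; 1; 0; 1]; [:: 0; 2; 0; 2]; [:: 0; 1; 0; 2]]%N.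

Fixpoint collapsing_conjugate (fuel : nat) (e : trefoil) : bool :=
  if collapsing e then true else
  if fuel is f.+1 then collapsing_conjugate f (rotate_trefoil e) else false.

Definition collapsing_word (xs : seq nat) (w : word) : bool :=
  let e := trefoil_value xs w (0, 0, [::])%N in
  collapsing_conjugate (size e.2) e.

Section Trefoil.
Local Open Scope group_scope.
Context (G : groupType) (tfG : torsion_free G) (a b : G).
Hypothesis ab : a * a = b * b * b.

Let c := a * a.

Let ca m : commute a (expz _ c m).
Proof. by apply: commute_expz; apply: mulgA. Qed.

Let cb m : commute b (expz _ c m).
Proof. by apply: commute_expz; rewrite /c ab /commute !mulgA. Qed.

Let c1_commute : c = 1 -> commute a b.
Proof. by move=> c1; rewrite (tfG a 2) //; apply/commute_sym/commute1. Qed.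

Let cm_commute m : expz _ c m = 1 -> m != 0%R -> commute a b.
Proof. by move=> cm /eqP m0; apply/c1_commute/(expz_eq1 _ c m). Qed.

Definition letter (l : nat) : G := nth 1 [:: a; b; b^-1] l.

Definition spell (s : seq nat) : G := foldr (fun l g => letter l * g) 1 s.

Definition trefoil_eval (e : trefoil) : G :=
  expz _ c (e.1.1%:Z - e.1.2%:Z)%R * spell e.2.

Local Notation small := (fun l : nat => l < 3)%N.

Lemma letter_central l m : (l < 3)%N -> commute (letter l) (expz _ c m).
Proof.
case: l => [|[|[|]]] //= _.
by apply/commute_sym/commuteV/commute_sym/cb.
Qed.

Lemma push_eval l e : (l < 3)%N -> all small e.2 ->
  trefoil_eval (push l e) = letter l * trefoil_eval e /\ all small (push l e).2.
Proof.
move=> l3; case: e => [[p q] s] /= s3.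
have pE : (p.+1%:Z - q%:Z = p%:Z - q%:Z + 1)%R by lia.
have qE : (p%:Z - q.+1%:Z = p%:Z - q%:Z + (-1))%R by lia.
move mE: (p%:Z - q%:Z)%R pE qE => m pE qE.
rewrite /trefoil_eval /= mE mulgA letter_central // -mulgA.
case: l l3 s s3 => [|[|[|]]] //= _ [|[|[|[|]]] s] //= s3;
  rewrite ?pE ?qE ?mE ?expzD -?mulgA; split=> //; congr (_ * _).
- by rewrite /= mulgA ab -!mulgA mulVKg.
- by rewrite /= mulVKg.
- by rewrite /= mulKg.
- by rewrite /= /c ab !invgM -!mulgA mulKg.
Qed.

Lemma push_inverse_eval l e : (l < 3)%N -> all small e.2 ->
  trefoil_eval (push_inverse l e) = (letter l)^-1 * trefoil_eval e /\
  all small (push_inverse l e).2.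
Proof.
case: l => [|[|[|]]] //= _ e3; last by rewrite invgK; apply: push_eval.
  have [] := push_eval 0 e isT e3; case: (push 0 e) => [[p q] s] /= pE s3.
  split=> //; move: pE; rewrite /trefoil_eval /=.
  have -> : (p%:Z - q.+1%:Z = -1 + (p%:Z - q%:Z))%R by lia.
  by move=> pE; rewrite (expzD _ _ (-1)%R) -mulgA pE /= /c invgM -!mulgA mulKg.
exact: (push_eval 2).
Qed.

Lemma trefoil_value_eval xs w e : all small xs ->
  coloured w -> all small e.2 ->
  trefoil_eval (trefoil_value xs w e) =
    walk_value _ (nth 1 [:: 1; spell xs; b]) w * trefoil_eval e /\
  all small (trefoil_value xs w e).2.
Proof.
move=> xs3; elim: w e => [|s w IHw] e /=; first by rewrite mul1g.
move=> /andP[/andP[s1 s2] w3] e3.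
have letters3 i : (i < 3)%N -> all small (trefoil_letters xs i) /\
    nth 1 [:: 1; spell xs; b] i = spell (trefoil_letters xs i).
  by case: i => [|[|[|]]] //=; rewrite mulg1.
have [[l1 ->] [l2 ->]] := (letters3 _ s1, letters3 _ s2).
have pushes ls f : all small ls -> all small f.2 ->
    trefoil_eval (foldr push f ls) = spell ls * trefoil_eval f /\
    all small (foldr push f ls).2.
  move=> ls3 f3; elim: ls ls3 => [|l ls IHls] /=; first by rewrite mul1g.
  move=> /andP[l3 /IHls[fE f3']]; have [-> ?] := push_eval l _ l3 f3'.
  by rewrite fE mulgA.
have pulls ls f : all small ls -> all small f.2 ->
    trefoil_eval (foldl (fun e l => push_inverse l e) f ls) =
      (spell ls)^-1 * trefoil_eval f /\
    all small (foldl (fun e l => push_inverse l e) f ls).2.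
  elim: ls f => [|l ls IHls] f /=; first by rewrite invg1 mul1g.
  move=> /andP[l3 ls3] f3; have [fE f3'] := push_inverse_eval l _ l3 f3.
  by have [-> ?] := IHls _ ls3 f3'; rewrite fE invgM mulgA.
have [e1E e13] := pushes _ _ l1 e3; have [e2E e23] := pulls _ _ l2 e13.
by have [-> ?] := IHw _ w3 e23; rewrite e2E e1E !mulgA.
Qed.

(** The word [s] equals a power [c^m], which is central. Either this makes [a] and [b] commute at
    once, or two different powers of [c] agree; then [c = 1] by torsion-freeness, and so [a = 1]. *)
Lemma collapsing_commute e : collapsing e -> trefoil_eval e = 1 -> commute a b.
Proof.
case: e => [[p q] s]; rewrite /trefoil_eval /=.
case: s => [|l s] bad; first by rewrite mulg1 => /cm_commute; apply; lia.
move: bad; case: ifP => // _; move: (l :: s) => {l}s bad.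
move mE: (q%:Z - p%:Z)%R => m.
have -> : (p%:Z - q%:Z = - m)%R by lia.
rewrite expzN => /mulg1_eq/esym; rewrite invgK => spellE.
have b3 : expz _ b 3 = c by rewrite /c ab /= !expgS mulg1 !mulgA.
have bV : commute a b^-1 -> commute a b by move=> /commuteV; rewrite invgK.
have cancel_a z : commute a (a * z) -> commute a z.
  by rewrite /commute -mulgA => /mulgI.
have conj_eq z : a * z * a * z = expz _ c m -> commute z c ->
    a * z * a^-1 = expz _ c (m - 1)%R * z^-1.
  move=> zE zc; apply: (mulIg (c * z)).
  rewrite -[RHS]mulgA -{2}zc mulKg -expzS GRing.subrK -zE /c !mulgA.
  by rewrite mulgVK.
have zc : commute b c /\ commute b^-1 c.
  by split; [|apply/commute_sym/commuteV/commute_sym]; apply: (cb 1).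
have cE n k : expz _ c n = expz _ c k -> n <> k -> commute a b.
  move=> nk ne; apply: (cm_commute (n - k)%R); last by lia.
  by rewrite expzD expzN nk mulgV.
have ac : a * c * a^-1 = c by rewrite -[c]/(expz _ c 1) ca mulgK.
have acV : a * c^-1 * a^-1 = c^-1 by rewrite -[c^-1]/(expz _ c (-1)) ca mulgK.
have bN3 : expz _ b^-1 3 = c^-1.
  by rewrite -b3 /= !expgS !mulg1 !invgM !mulgA.
move: bad spellE; rewrite !inE; do 7?[case/predU1P=> [->|]]; last move/eqP->;
  rewrite /= /letter /= !mulg1 ?mulgA => spellE.
- by rewrite spellE; apply/commute_sym/cb.
- by rewrite spellE; apply: ca.
- by apply: bV; rewrite spellE; apply: ca.
- by apply: cancel_a; rewrite spellE; apply: ca.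
- by apply/bV/cancel_a; rewrite spellE; apply: ca.
(* The cube of [a b a^-1 = c^(m-1) b^-1] is [c = c^(3m-4)], with exponents that differ modulo 3; the
   next case is similar with [b^-1] for [b]. *)
- have := congr1 (fun g => expz _ g 3) (conj_eq b spellE zc.1).
  rewrite -expzJ b3 ac expzMn; last exact/commuteV/commute_sym/cb.
  rewrite -expzM bN3 -[X in X = _]/(expz _ c 1) -[c^-1]/(expz _ c (-1)) -expzD.
  by move=> /cE; apply; lia.
- have := congr1 (fun g => expz _ g 3) (conj_eq b^-1 spellE zc.2).
  rewrite -expzJ bN3 acV invgK expzMn; last exact/commute_sym/cb.
  rewrite -expzM b3 -[c^-1]/(expz _ c (-1)) -[X in _ = _ * X]/(expz _ c 1) -expzD.
  by move=> /cE; apply; lia.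
have bab : b * a * b^-1 = expz _ c (m - 1)%R * a.
  apply: (mulgI a); rewrite [RHS]mulgA ca -[RHS]mulgA -/c -expzS GRing.subrK -spellE.
  by rewrite !mulgA.
have [m1|m1] := eqVneq m 1%R.
  move: bab; rewrite m1 GRing.subrr mul1g => ba.
  by rewrite /commute -{1}ba mulgVK.
(* The square is [c = c^(2m-1)], where the exponents agree only for [m = 1]. *)
have := congr1 (fun g => expz _ g 2) bab.
rewrite -expzJ expzMn; last exact/commute_sym/ca.
rewrite -expzM [expz _ a 2]expg2 -/c [b * c]zc.1 mulgK -expzS.
by move=> /(cE 1%R); apply; lia.
Qed.

Lemma rotate_trefoil_eval e : all small e.2 -> trefoil_eval e = 1 ->
  trefoil_eval (rotate_trefoil e) = 1 /\ all small (rotate_trefoil e).2.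
Proof.
case: e => [[p q] [|l s]] //= s3 e1.
have [l3 b3] : (last l s < 3)%N /\ all small (belast l s).
  have : all small (rcons (belast l s) (last l s)) by rewrite -lastI.
  by rewrite all_rcons => /andP.
have [-> ->] := push_eval (last l s) (p, q, belast l s) l3 b3; split=> //.
have : spell (l :: s) = spell (belast l s) * letter (last l s).
  rewrite lastI; elim: (belast l s) => [|k ls IHls] /=; first by rewrite mulg1 mul1g.
  by rewrite IHls mulgA.
move: e1; rewrite /trefoil_eval /= => e1 sE.
rewrite sE mulgA in e1; apply: (mulIg (letter (last l s))).
by rewrite mul1g -mulgA e1 mulg1.
Qed.

Lemma collapsing_conjugate_commute fuel e : all small e.2 ->
  collapsing_conjugate fuel e -> trefoil_eval e = 1 -> commute a b.
Proof.
elim: fuel e => [|f IHf] e e3 /=; case: ifP => // bad;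
  first by move=> _; apply: collapsing_commute.
  by move=> _; apply: collapsing_commute.
by move=> rbad /(rotate_trefoil_eval e e3)[re1 re3]; apply: IHf re1.
Qed.

Lemma collapsing_word_commute xs w : all small xs ->
  coloured w -> collapsing_word xs w ->
  walk_value _ (nth 1 [:: 1; spell xs; b]) w = 1 -> commute a b.
Proof.
move=> xs3 w3 bad w1.
have [e1 e3] := trefoil_value_eval xs w (0, 0, [::])%N xs3 w3 isT.
move: e1; rewrite w1 mul1g [RHS]mulg1; exact: collapsing_conjugate_commute bad.
Qed.

End Trefoil.

(** * Exhaustive search *)

(* The slot (k, i) stands for the product of h_i and the k-th vertex. *)
Definition slot : Type := (nat * nat)%type.
Definition slots (n : nat) : seq slot := [seq (k, i) | k <- iota 0 n, i <- colours].

(* Unlike [has], lazy even under call-by-value evaluation. *)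
Fixpoint any T (p : T -> bool) (s : seq T) : bool :=
  if s is x :: s' then if p x then true else any T p s' else false.

Lemma anyE T (p : T -> bool) s : any T p s = has p s.
Proof. by elim: s => //= x s <-; case: (p x). Qed.

Arguments any : simpl never.

Section Search.
Variables (bad : word -> bool) (depth lim : nat).

(** Looks for a bad closed walk of at most [fuel] further steps: cross from [s] to another slot of
    its group, then leave the vertex reached by a different slot, since otherwise two steps would
    merge into one. *)
Fixpoint closes fuel (gs : seq (seq slot)) (target : nat) (w : word) (s : slot) :=
  if fuel is f.+1 then
    any _ (fun g : seq slot =>
      if s \in g then
        any _ (fun t : slot =>
          if t.1 == s.1 then false else
          let w' := rcons w (s.2, t.2) in
          if t.1 == target then bad w' else
          any _ (fun c => if c == t.2 then false
                          else closes f gs target w' (t.1, c)) colours) g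
      else false) gs
  else false.

Definition open_slots n (gs : seq (seq slot)) : seq slot :=
  [seq s <- slots n | ~~ has (fun g : seq slot => s \in g) gs].

(** Distinct slots with a common vertex or a common index never give equal products, by injectivity
    of [h] and cancellation. *)
Definition clash (s t : slot) : bool := (s.1 == t.1) || (s.2 == t.2).

(* A state consists of [n] vertices (elements of B) and of groups of slots that
   give the same product. A group with one slot marks the unmatched slot; once
   [d] is false no further slot may be unmatched. Only the slots of the first
   [lim] vertices are explored, and [true] means that every branch is refuted. *)
Fixpoint search fuel (d : bool) n (gs : seq (seq slot)) : bool :=
  if fuel is f.+1 then
    if [seq s <- open_slots n gs | (s.1 < lim)%N] is s :: _ then
      [&& if d then search f false n ([:: s] :: gs) else true,
          all (fun t => if clash s t then true else
                 let gs' := [:: s; t] :: gs in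
                 if closes depth gs' s.1 [::] s then true
                 else search f d n gs') (open_slots n gs),
          all (fun g : seq slot => if (size g < 2)%N then true else
                 if has (clash s) g then true else
                 let gs' := (s :: g) :: rem g gs in
                 if closes depth gs' s.1 [::] s then true
                 else search f d n gs') gs
        & if (n < 9)%N then
            all (fun i => if i == s.2 then true
                          else search f d n.+1 ([:: s; (n, i)] :: gs)) colours
          else true]
    else false
  else false.

Section Soundness.
Local Open Scope group_scope.
Context (G : groupType) (h : nat -> G) (B : seq G).
Hypothesis Bconf : configuration G h B.
Hypothesis bad_excluded : forall w, coloured w -> bad w -> ~ closed_walk G h B w.

Definition product (v : seq G) (s : slot) : G := h s.2 * nth 1 v s.1.

Record models (v : seq G) (gs : seq (seq slot)) : Prop := Models {
  models_uniq : uniq v;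
  models_sub : {subset v <= B};
  models_slot : forall g s, g \in gs -> s \in g -> (s.1 < size v)%N && (s.2 < 3)%N;
  models_eq : forall g s t, g \in gs -> s \in g -> t \in g ->
    product v s = product v t;
  models_unm : forall s, [:: s] \in gs -> unmatched G h B (nth 1 v s.1) s.2 }.

Lemma models_cons v g gs : models v gs -> (1 < size g)%N ->
  (forall s, s \in g -> (s.1 < size v)%N && (s.2 < 3)%N) ->
  (forall s t, s \in g -> t \in g -> product v s = product v t) ->
  models v (g :: gs).
Proof.
move=> [uv sv vs ve vu] g1 g_slot gE; split=> // [g' s|g' s t|s].
- by rewrite inE => /predU1P[->|]; [apply: g_slot | apply: vs].
- by rewrite inE => /predU1P[->|]; [apply: gE | apply: ve].
by rewrite inE => /predU1P[gE'|]; [rewrite -gE' in g1 | apply: vu].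
Qed.

Lemma models_subset v gs gs' : {subset gs' <= gs} -> models v gs -> models v gs'.
Proof.
move=> sub [uv sv vs ve vu]; split=> // [g s /sub|g s t /sub|s /sub].
- exact: vs.
- exact: ve.
exact: vu.
Qed.

Lemma models_rcons v b gs : b \in B -> b \notin v -> models v gs -> models (rcons v b) gs.
Proof.
move=> bB bv [uv sv vs ve vu].
have nthE s g : g \in gs -> s \in g -> nth 1 (rcons v b) s.1 = nth 1 v s.1.
  by move=> gs_g /(vs _ _ gs_g)/andP[s1 _]; rewrite nth_rcons s1.
split=> [||g s gs_g sg|g s t gs_g sg tg|s gs_s].
- by rewrite rcons_uniq bv.
- by move=> x; rewrite mem_rcons inE => /predU1P[->|/sv].
- by have /andP[s1 s2] := vs _ _ gs_g sg; rewrite size_rcons ltnS ltnW.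
- by rewrite /product !(nthE _ g) //; apply: ve gs_g sg tg.
by rewrite (nthE _ [:: s]) ?mem_head //; apply: vu.
Qed.

Lemma closes_sound fuel gs v target w s : models v gs -> (target < size v)%N ->
  coloured w -> walk G h B (nth 1 v target) w (nth 1 v s.1) ->
  closes fuel gs target w s -> False.
Proof.
move=> mv tgt; have vB k : (k < size v)%N -> nth 1 v k \in B.
  by move=> kv; apply/(models_sub _ _ mv)/mem_nth.
elim: fuel w s => //= f IHf w s cw ws; rewrite anyE => /hasP[g g_in].
case: ifP => // sg; rewrite anyE => /hasP[u ug]; case: ifP => // us.
have /andP[s1 s2] := models_slot _ _ mv _ _ g_in sg.
have /andP[u1 u2] := models_slot _ _ mv _ _ g_in ug.
have cw' : coloured (rcons w (s.2, u.2)) by rewrite /coloured all_rcons /= s2 u2.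
have wu : walk G h B (nth 1 v target) (rcons w (s.2, u.2)) (nth 1 v u.1).
  rewrite -cats1; apply/walk_cat; first exact: vB.
  exists (nth 1 v s.1); split=> //=; first exact: vB.
  exists (nth 1 v u.1); split=> //; first exact: vB.
  exact: (models_eq _ _ mv _ _ _ g_in sg ug).
case: ifP => [/eqP ut /(bad_excluded _ cw')|ut].
  by apply; exists (nth 1 v target); [exact: vB | rewrite -{2}ut].
by rewrite anyE => /hasP[c _]; case: ifP => // _; apply: IHf.
Qed.

(** The two justifications for [d = false]: the unique unmatched pair is already recorded, or it
    lies outside the explored vertices. *)
Definition saturated v (gs : seq (seq slot)) : Prop :=
  (exists s : slot, [:: s] \in gs) \/
  (lim <= size v)%N /\ forall k i, (k < lim)%N -> (i < 3)%N ->
    ~ unmatched G h B (nth 1 v k) i.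

(** The chosen open slot is unmatched, or matched with an open slot, with a slot of a group, or with
    a new vertex: one conjunct of [search] for each case. A branch cut by [closes] contains an
    excluded closed walk. *)
Lemma search_sound fuel d v gs : models v gs -> (d = false -> saturated v gs) ->
  search fuel d (size v) gs -> False.
Proof.
elim: fuel d v gs => //= f IHf d v gs mv sat.
case fE: [seq s <- _ | _] => [//|s ss].
have : s \in [seq s <- open_slots (size v) gs | (s.1 < lim)%N] by rewrite fE mem_head.
rewrite 2!mem_filter => /and3P[s_lim s_open].
have mem_slots t : (t \in slots (size v)) = (t.1 < size v)%N && (t.2 < 3)%N.
  case: t => k i; apply/allpairsP/andP => [[[k' i'] /= [k_in i_in [-> ->]]]|/= [k_lt i_lt]].
    move: k_in i_in; rewrite mem_iota !inE => k_lt.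
    by case/or3P=> /eqP->; split.
  exists (k, i); rewrite mem_iota; split=> //.
  by case: i i_lt => [|[|[]]].
rewrite mem_slots => /andP[s1 s2].
have not_in g : g \in gs -> s \notin g by move=> g_in; move/hasPn: s_open => /(_ g g_in).
set x := nth 1 v s.1; have xv : x \in v by apply: mem_nth.
have xB : x \in B by apply: (models_sub _ _ mv).
have slot_eq t : (t.1 < size v)%N -> nth 1 v t.1 = x -> t.2 = s.2 -> t = s.
  move=> t1 tx t2; rewrite [t]surjective_pairing [RHS]surjective_pairing t2.
  congr (_, _); apply/eqP.
  by rewrite -(nth_uniq 1 t1 s1 (models_uniq _ _ mv)) tx.
case/and4P=> defect join_open join_group new.
have [unm|] := unmatched_or_match _ _ _ _ _ Bconf xB s2.
  case: d sat defect {join_open join_group new} => sat.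
    apply: IHf => [|_]; last by left; exists s; apply: mem_head.
    have [uv sv vs ve vu] := mv; split=> // [g t|g t u|t]; rewrite inE.
    - by case/predU1P=> [->|]; [rewrite inE => /eqP-> ; rewrite s1 s2 | apply: vs].
    - by case/predU1P=> [->|]; [rewrite !inE => /eqP-> /eqP-> | apply: ve].
    by case/predU1P=> [[->]|]; last exact: vu.
  move=> _; case: (sat erefl) => [[t gs_t]|[_ /(_ _ _ s_lim s2)]] //.
  have := models_unm _ _ mv _ gs_t => unm_t.
  have [e1 e2] := conf_unmatched _ _ _ Bconf _ _ _ _ unm_t unm.
  have /andP[t1 _] := models_slot _ _ mv _ _ gs_t (mem_head _ _).
  by have := not_in _ gs_t; rewrite (slot_eq t t1 e1 e2) mem_head.
move=> [b [i [bB i3 is2 xb hb]]].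
have i_col : i \in colours by case: i i3 {is2 hb} => [|[|[]]].
have closes_absurd gs' : models v gs' -> closes depth gs' s.1 [::] s = false.
  move=> mv'; apply/negP; exact: (closes_sound _ _ _ _ _ _ mv' s1).
have eq_slot t : (t.1 < size v)%N -> (t.2 < 3)%N -> product v s = product v t ->
    clash s t -> t = s.
  rewrite /product -/x => t1 t2 e; case/orP=> /eqP e'.
    have tx : nth 1 v t.1 = x by rewrite -e'.
    apply: slot_eq => //; apply/esym/(conf_inj _ _ _ Bconf) => //.
    by apply: (mulIg x); rewrite e tx.
  by apply: slot_eq => //; apply: (mulgI (h s.2)); rewrite e e'.
have [bv|bv] := boolP (b \in v); last first.
  (* The vertices are distinct elements of [B], so the size bound rules out a tenth one. *)
  have vb9 : (size (rcons v b) <= 9)%N.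
    apply: leq_trans (conf_size _ _ _ Bconf); apply: uniq_leq_size.
      by rewrite rcons_uniq bv (models_uniq _ _ mv).
    by move=> y; rewrite mem_rcons inE => /predU1P[->|/(models_sub _ _ mv)].
  rewrite size_rcons in vb9; rewrite vb9 in new.
  have /allP/(_ i i_col) : all (fun i => if i == s.2 then true else
    search f d (size v).+1 ([:: s; (size v, i)] :: gs)) colours := new.
  rewrite (negPf is2) -(size_rcons v b); apply: IHf.
    have nthb : nth 1 (rcons v b) (size v) = b by rewrite nth_rcons ltnn eqxx.
    have nths : nth 1 (rcons v b) s.1 = x by rewrite nth_rcons s1.
    apply: models_cons => //; first exact: models_rcons.
      move=> t; rewrite !inE size_rcons => /orP[]/eqP-> /=; last by rewrite ltnSn.
      by rewrite s2 ltnS ltnW.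
    by move=> t u; rewrite !inE /product => /orP[]/eqP-> /orP[]/eqP-> /=;
       rewrite ?nthb ?nths.
  move=> /sat[[t gs_t]|[lim_v nov]]; first by left; exists t; rewrite inE gs_t orbT.
  right; rewrite size_rcons; split; first exact: leqW.
  by move=> k j k_lim j3; rewrite nth_rcons (leq_trans k_lim lim_v); apply: nov.
pose t : slot := (index b v, i).
have t1 : (t.1 < size v)%N by rewrite index_mem.
have st : product v s = product v t by rewrite /product /t /= nth_index.
have nclash : clash s t = false.
  apply/negP => /(eq_slot _ t1 i3 st) e; move: xb.
  by rewrite /x -e /t /= nth_index ?eqxx.
have [t_open|] := boolP (t \in open_slots (size v) gs).
  move/allP: join_open => /(_ t t_open); rewrite nclash.
  have mv' : models v ([:: s; t] :: gs).
    apply: models_cons => // u; first by rewrite !inE => /orP[]/eqP->; rewrite ?s1 ?t1.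
    by move=> u'; rewrite !inE => /orP[]/eqP-> /orP[]/eqP->.
  rewrite /= closes_absurd //; apply: IHf => //.
  by move=> /sat[[u gs_u]|]; [left; exists u; rewrite inE gs_u orbT | right].
rewrite mem_filter mem_slots t1 (i3 : (t.2 < 3)%N) !andbT negbK => /hasP[g g_in tg].
(* A group with a single slot records an unmatched product, which no other slot can join. *)
move/allP: join_group => /(_ g g_in); case: ltnP => [g1 _|g1].
  have gE : g = [:: t].
    by case: g tg g1 {g_in} => [|u [|//]] //; rewrite inE => /eqP->.
  have := models_unm _ _ mv t; rewrite -gE => /(_ g_in)[_ _ /(_ x s.2 xB s2)].
  rewrite /t /= nth_index // -hb => /(_ erefl)[bx _].
  by rewrite bx eqxx in xb.
have eq_g u : u \in g -> product v s = product v u.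
  by move=> ug; rewrite st; apply: (models_eq _ _ mv _ _ _ g_in tg ug).
case: ifP => [/hasP[u ug su]|_].
  have /andP[u1 u2] := models_slot _ _ mv _ _ g_in ug.
  by have := not_in _ g_in; rewrite -(eq_slot u u1 u2 (eq_g u ug) su) ug.
have mv' : models v ((s :: g) :: rem g gs).
  apply: models_cons; [|exact: ltnW|move=> u|move=> u u'].
  - by apply: models_subset mv => y; apply: mem_rem.
  - rewrite inE => /predU1P[->|ug]; first by rewrite s1.
    exact: (models_slot _ _ mv _ _ g_in ug).
  by rewrite !inE => /predU1P[->|/eq_g<-] /predU1P[->|/eq_g<-].
rewrite /= closes_absurd //; apply: IHf => //.
move=> /sat[[u gs_u]|]; last by right.
left; exists u; rewrite inE.
have := perm_mem (perm_to_rem g_in) [:: u]; rewrite gs_u inE => /esym/predU1P[gE|->].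
  by rewrite -gE in g1.
exact: orbT.
Qed.

End Soundness.
End Search.

(** * Cyclic words of length at most four and the computed searches *)

Definition cyclically_reduced (w : word) : bool :=
  cycle (fun s t : step => s.2 != t.1) w && all [in steps] w.

Fixpoint words (n : nat) : seq word :=
  if n is n'.+1 then [seq s :: w | s <- steps, w <- words n'] else [:: [::]].

Definition short_relators : seq word :=
  [:: [:: (1, 0); (1, 0)]; [:: (2, 0); (1, 0)];
      [:: (1, 0); (1, 0); (1, 0)]; [:: (2, 0); (1, 0); (1, 0)];
      [:: (1, 0); (2, 0); (1, 2)]; [:: (1, 0); (2, 1); (0, 2)];
      [:: (1, 0); (1, 0); (1, 0); (1, 0)]; [:: (2, 0); (1, 0); (1, 0); (1, 0)];
      [:: (2, 0); (2, 0); (1, 0); (1, 0)]; [:: (1, 0); (1, 0); (2, 1); (0, 2)];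
      [:: (1, 0); (1, 0); (2, 0); (1, 2)]; [:: (2, 0); (1, 0); (2, 0); (1, 0)];
      [:: (1, 0); (2, 0); (1, 0); (1, 2)]; [:: (1, 0); (2, 0); (2, 1); (0, 2)]]%N.

(* The two remaining cyclic words of length 4, with relators y y x y^-1 x and
   x^-1 y^-1 x^-1 y y. Both define the trefoil group. *)
Definition trefoil_word1 : word := [:: (1, 2); (1, 0); (2, 0); (2, 0)]%N.
Definition trefoil_word2 : word := [:: (2, 0); (2, 1); (0, 2); (0, 1)]%N.

(** The list [allowed] holds the words whose exclusion is not yet available, so that no search
    relies on them prematurely. *)
Definition short_word (allowed : seq word) (w : word) : bool :=
  if (1 < size w <= 4)%N then cyclically_reduced w && (w \notin allowed) else false.

Definition orbit1 : seq word := Eval vm_compute in orbit trefoil_word1.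
Definition orbit2 : seq word := Eval vm_compute in orbit trefoil_word2.

Lemma mem_words w : all [in steps] w -> w \in words (size w).
Proof.
elim: w => [//|s w IHw] /andP[s_in /IHw w_in].
exact: (allpairs_f cons s_in w_in).
Qed.

(** Checked by computation on all words of length 2, 3 and 4. *)
Lemma short_word_orbit w : short_word (orbit1 ++ orbit2) w ->
  w \in flatten [seq orbit r | r <- short_relators].
Proof.
rewrite /short_word; case: ifP => // w_size /andP[w_red w_out].
have : all (fun u => if cyclically_reduced u then
    (u \in orbit1 ++ orbit2 ++ flatten [seq orbit r | r <- short_relators])
    else true) (flatten [seq words n | n <- [:: 2; 3; 4]%N]).
  by vm_cast_no_check (erefl true).
have w_in : w \in flatten [seq words n | n <- [:: 2; 3; 4]%N].
  apply/flatten_mapP; exists (size w); last by apply: mem_words; case/andP: w_red.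
  by move: (size w) w_size => [|[|[|[|[|]]]]].
move=> /allP/(_ w w_in); rewrite w_red catA mem_cat (negPf w_out).
by [].
Qed.

Definition search_bad (allowed : seq word) (xs : seq nat) (w : word) : bool :=
  if short_word allowed w then true else collapsing_word xs w.

Definition cycle_groups (w : word) : seq (seq slot) :=
  [seq [:: (k, (nth (0, 0) w k).1); (k.+1 %% 4, (nth (0, 0) w k).2)]%N | k <- iota 0 4].

(** Here [x = b^-1 a b^-1], closed walks of up to 5 steps are tested, and all 9 possible vertices
    are explored. The fuel 24 exceeds the 19 slots left open among 27 by the initial cycle. *)
Lemma search_trefoil1 :
  search (search_bad (orbit1 ++ orbit2) [:: 2; 0; 2]%N) 5 9 24 true 4
    (cycle_groups trefoil_word1).
Proof. by vm_cast_no_check (erefl true). Qed.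

(** Here [x = a b^-1]; the words of [orbit1] may already be used as excluded. *)
Lemma search_trefoil2 :
  search (search_bad orbit2 [:: 0; 2]%N) 5 9 24 true 4
    (cycle_groups trefoil_word2).
Proof. by vm_cast_no_check (erefl true). Qed.

(** Vertex 0 is matched with three neighbours. Without short closed walks, their six other slots
    need six new vertices, which makes ten. *)
Lemma search_ball : all (fun i0 => all (fun i1 => all (fun i2 =>
    if [|| i0 == 0, i1 == 1 | i2 == 2]%N then true else
    search (short_word [::]) 4 4 24 false 4
      [:: [:: (0, 0); (1, i0)]; [:: (0, 1); (2, i1)]; [:: (0, 2); (3, i2)]]%N)
  colours) colours) colours.
Proof. by vm_cast_no_check (erefl true). Qed.

(** * Absence of configurations *)

Section NoConfiguration.
Local Open Scope group_scope.
Context (G : groupType) (tfG : torsion_free G).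

Lemma excluded_short allowed w :
  (forall u, u \in orbit1 ++ orbit2 -> u \notin allowed -> excluded G u) ->
  short_word allowed w -> excluded G w.
Proof.
move=> ex_orbits w_short.
have [w_in|w_out] := boolP (w \in orbit1 ++ orbit2).
  apply: (ex_orbits w w_in); move: w_short; rewrite /short_word.
  by case: ifP => // _ /andP[].
have : short_word (orbit1 ++ orbit2) w.
  by move: w_short; rewrite /short_word; case: ifP => // _ /andP[-> _].
move=> /short_word_orbit/flatten_mapP[r r_in]; apply: excluded_orbit.
move: r_in; rewrite !inE; do 13?[case/predU1P=> [->|]]; last move/eqP->.
- exact: excluded_x2.
- exact: excluded_xy.
- exact: excluded_x3.
- exact: excluded_xxy.
- exact: excluded_Yxyx.
- exact: excluded_commutator.
- exact: excluded_x4.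
- exact: excluded_xxxy.
- exact: excluded_xxyy.
- exact: excluded_YXyxx.
- exact: excluded_Yxyxx.
- exact: excluded_xyxy.
- exact: excluded_Yxxyx.
exact: excluded_YXyyx.
Qed.

(** Both trefoil words have length 4, so shorter words are excluded independently of them; this is
    what makes the vertices of the initial four-cycles distinct. *)
Lemma excluded_short3 w : (size w < 4)%N -> short_word [::] w -> excluded G w.
Proof.
move=> w4 w_short; apply: (excluded_short (orbit1 ++ orbit2)) => [u ->//|].
have /allP orbits4 : all (fun u => size u == 4) (orbit1 ++ orbit2) by [].
move: w_short; rewrite /short_word; case: ifP => // _ /andP[-> _] /=.
by apply: contraTN w4 => /orbits4/eqP->.
Qed.

Lemma step_lt3 s : s \in steps -> [/\ (s.1 < 3)%N, (s.2 < 3)%N & s.1 != s.2].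
Proof.
have /allP steps3 : all (fun t => [&& t.1 < 3, t.2 < 3 & t.1 != t.2])%N steps by [].
by move=> /steps3/and3P.
Qed.

Lemma mem_steps i j : (i < 3)%N -> (j < 3)%N -> i != j -> (i, j) \in steps.
Proof. by case: i => [|[|[|]]] //; case: j => [|[|[|]]]. Qed.

Lemma step_neq h B b s b' : configuration G h B -> s \in steps ->
  h s.1 * b = h s.2 * b' -> b != b'.
Proof.
move=> Bconf /step_lt3[l1 l2 s12] hb.
apply: contraNneq s12 => bb'; rewrite bb' in hb; apply/eqP.
by apply: (conf_inj _ _ _ Bconf) => //; apply: mulIg hb.
Qed.

(** If [b = b'], the two steps form an excluded closed walk, unless [t.2 = s.1]; then cancellation
    gives [s.2 = t.1]. *)
Lemma two_steps_neq h B b s t b' : configuration G h B -> b \in B ->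
  s \in steps -> t \in steps -> s.2 != t.1 -> walk G h B b [:: s; t] b' -> b != b'.
Proof.
move=> Bconf bB s_in t_in st w; apply/eqP=> e; subst b'.
have [_ s2 _] := step_lt3 s s_in; have [t1 _ _] := step_lt3 t t_in.
have [ts|ts] := eqVneq t.2 s.1.
  case: w => b1 [b1B e1 [b2 [_ + e]]]; rewrite e ts e1 => /mulIg e2.
  by move: st; rewrite (conf_inj _ _ _ Bconf _ _ t1 s2 e2) eqxx.
have ex : excluded G [:: s; t].
  by apply: excluded_short3; rewrite // /short_word /cyclically_reduced /= st ts s_in t_in.
by apply: (ex h B Bconf); exists b.
Qed.

Lemma four_cycle_models h B s0 s1 s2 s3 : configuration G h B ->
  cyclically_reduced [:: s0; s1; s2; s3] -> closed_walk G h B [:: s0; s1; s2; s3] ->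
  exists2 v, models G h B v (cycle_groups [:: s0; s1; s2; s3]) & size v = 4.
Proof.
move=> Bconf /andP[/and5P[r01 r12 r23 r30 _] /and5P[i0 i1 i2 i3 _]].
case=> b0 b0B [b1 [b1B e0 [b2 [b2B e1 [b3 [b3B e2 [b4 [_ e3 e]]]]]]]].
rewrite {b4}e in e3.
have neq s b b' := step_neq h B b s b' Bconf.
have n02 : b0 != b2.
  apply: (two_steps_neq h B b0 s0 s1) => //.
  by exists b1; split=> //; exists b2.
have n13 : b1 != b3.
  apply: (two_steps_neq h B b1 s1 s2) => //.
  by exists b2; split=> //; exists b3.
exists [:: b0; b1; b2; b3] => //; rewrite /cycle_groups /=.
have lt3 s : s \in steps -> (s.1 < 3)%N && (s.2 < 3)%N.
  by move=> /step_lt3[-> ->].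
have [/andP[l0 l0'] /andP[l1 l1']] := (lt3 _ i0, lt3 _ i1).
have [/andP[l2 l2'] /andP[l3 l3']] := (lt3 _ i2, lt3 _ i3).
split=> /= [|x|g s|g s t|s].
- rewrite !inE !negb_or n02 n13 (neq _ _ _ i0 e0) (neq _ _ _ i1 e1).
  by rewrite (neq _ _ _ i2 e2) eq_sym (neq _ _ _ i3 e3).
- by rewrite !inE => /or4P[]/eqP->.
- by rewrite !inE => /or4P[]/eqP->; rewrite !inE => /orP[]/eqP->.
- by rewrite !inE => /or4P[]/eqP->; rewrite !inE => /orP[]/eqP-> /orP[]/eqP->.
by rewrite !inE => /or4P[]/eqP.
Qed.

(** The relator turns [x] and [y] into elements of a trefoil group generated by [a] and [b = y].
    Every matching found by the search then closes a short excluded walk, or one whose relator makes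
    [a] and [y], hence [x] and [y], commute. *)
Lemma excluded_trefoil xs allowed (s0 s1 s2 s3 : step) :
  let w := [:: s0; s1; s2; s3] in
  coloured w -> cyclically_reduced w -> all (fun l => l < 3)%N xs ->
  (forall u, u \in orbit1 ++ orbit2 -> u \notin allowed -> excluded G u) ->
  (forall x y : G, walk_value G (nth 1 [:: 1; x; y]) w = 1 ->
    exists a, [/\ a * a = y * y * y, x = spell G a y xs &
                  commute a y -> commute x y]) ->
  search (search_bad allowed xs) 5 9 24 true 4 (cycle_groups w) -> excluded G w.
Proof.
move=> w w3 w_red xs3 ex_orbits w_trefoil w_search h B Bconf w_closed.
have [a [ay xE axy]] := w_trefoil _ _ (closed_walk_value _ _ _ _ w3 w_closed).
have bad_excluded u : coloured u -> search_bad allowed xs u -> ~ closed_walk G h B u.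
  rewrite /search_bad => u3; case: ifP => [u_short _|_ u_bad] u_closed.
    exact: (excluded_short allowed u ex_orbits u_short h B Bconf).
  apply: (commuting_relation _ tfG h B _ _ Bconf (quotientsE _ h)); apply: axy.
  apply: (collapsing_word_commute _ tfG _ _ ay xs u xs3 u3 u_bad).
  by rewrite -xE; apply: closed_walk_value u_closed.
have [v v_models v4] := four_cycle_models h B s0 s1 s2 s3 Bconf w_red w_closed.
apply: (search_sound (search_bad allowed xs) 5 9 G h B Bconf bad_excluded 24 true
  v _ v_models) => //.
by rewrite v4.
Qed.

Lemma excluded_trefoil1 : excluded G trefoil_word1.
Proof.
apply: (excluded_trefoil [:: 2; 0; 2]%N (orbit1 ++ orbit2) (1, 2)%N (1, 0)%N
  (2, 0)%N (2, 0)%N isT isT isT _ _ search_trefoil1).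
  by move=> u ->.
(* Conjugated by [y x], the relator says [(y x y)^2 = y^3]. *)
move=> x y /=; rewrite ?invg1 ?mul1g ?mulg1 => E; exists (y * x * y).
split; [|by rewrite /= /letter /= !gnorm|].
  by apply: (eq_of_relator _ _ (y * x) _ _ E); rewrite !gnorm.
by rewrite /commute -!mulgA => /mulgI; rewrite !mulgA => /mulIg.
Qed.

Lemma excluded_trefoil2 : excluded G trefoil_word2.
Proof.
apply: (excluded_trefoil [:: 0; 2]%N orbit2 (2, 0)%N (2, 1)%N (0, 2)%N (0, 1)%N
  isT isT isT _ _ search_trefoil2).
  move=> u; rewrite mem_cat => /orP[u_in _|-> //].
  by apply: (excluded_orbit _ trefoil_word1 _ excluded_trefoil1).
(* The relator says [x y x = y^2], hence [(x y)^2 = y^3]. *)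
move=> x y /=; rewrite ?invg1 ?mul1g ?mulg1 => E; exists (x * y).
split; [|by rewrite /= /letter /= !gnorm|].
  by apply/esym/(eq_of_relator _ _ (x^-1 * y^-1 * x^-1)^-1 _ _ E); rewrite !gnorm.
by rewrite /commute !mulgA => /mulIg.
Qed.

Lemma excluded_short_word w : short_word [::] w -> excluded G w.
Proof.
apply: excluded_short => u; rewrite mem_cat => /orP[u_in|u_in] _.
  by apply: (excluded_orbit _ trefoil_word1 _ excluded_trefoil1).
by apply: (excluded_orbit _ trefoil_word2 _ excluded_trefoil2).
Qed.

(** If the closed walk is not cyclically reduced, [u] and [s] merge into the step [(u.1, s.2)],
    which leaves two steps or an equality of adjacent vertices. *)
Lemma three_steps_neq h B b s t u b' : configuration G h B -> b \in B ->
  s \in steps -> t \in steps -> u \in steps ->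
  s.2 != t.1 -> t.2 != u.1 -> walk G h B b [:: s; t; u] b' -> b != b'.
Proof.
move=> Bconf bB s_in t_in u_in st tu w; apply/eqP=> e; subst b'.
have [_ s2 _] := step_lt3 s s_in; have [u1 _ _] := step_lt3 u u_in.
have [us|us] := eqVneq u.2 s.1; last first.
  have ex : excluded G [:: s; t; u].
    apply: excluded_short3; rewrite // /short_word /cyclically_reduced /=.
    by rewrite st tu us s_in t_in u_in.
  by apply: (ex h B Bconf); exists b.
case: w => b1 [b1B e1 [b2 [b2B e2 [b3 [_ + e]]]]]; rewrite {b3}e us e1 => e3.
have [e4|us2] := eqVneq u.1 s.2.
  have := step_neq h B b1 t b2 Bconf t_in e2; rewrite e4 in e3.
  by rewrite (mulgI _ _ _ e3) eqxx.
have := two_steps_neq h B b1 t (u.1, s.2) b1 Bconf b1B t_in (mem_steps _ _ u1 s2 us2) tu.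
rewrite eqxx => absurd; suff: false by [].
by apply: absurd; exists b2; split=> //; exists b1.
Qed.

(* Two steps away from the vertex of the unmatched slot, neither a vertex nor its
   neighbours can be unmatched: short closed walks are excluded. *)
Lemma far_vertex h B : configuration G h B ->
  (forall b, b \in B -> (forall i, ~ unmatched G h B b i) ->
    (forall s b', s \in steps -> b' \in B -> h s.1 * b = h s.2 * b' ->
      forall i, ~ unmatched G h B b' i) -> False) -> False.
Proof.
move=> Bconf contra.
apply: (@double_neg_case (exists d i, unmatched G h B d i)) => [[d [i0 unm]]|nounm].
  have [dB i03 _] := unm.
  have only b i : unmatched G h B b i -> b = d /\ i = i0.
    by move=> unm'; apply: (conf_unmatched _ _ _ Bconf).
  have other c : exists2 k, (k < 3)%N & k != c.
    by case: c => [|c]; [exists 1%N | exists 0%N].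
  have [i1 i13 i10] := other i0.
  have [/only[_ e]|[b1 [j1 [b1B j13 ji1 b1d e1]]]] :=
    unmatched_or_match _ _ _ _ _ Bconf dB i13.
    by rewrite e eqxx in i10.
  have [k k3 kj1] := other j1.
  have [/only[e _]|[b2 [l [b2B l3 lk b21 e2]]]] :=
    unmatched_or_match _ _ _ _ _ Bconf b1B k3.
    by rewrite e eqxx in b1d.
  have s1 : (i1, j1) \in steps by apply: mem_steps => //; rewrite eq_sym.
  have s2 : (k, l) \in steps by apply: mem_steps => //; rewrite eq_sym.
  have jk : j1 != k by rewrite eq_sym.
  have d2 : d != b2.
    apply: (two_steps_neq h B d (i1, j1) (k, l) b2 Bconf dB s1 s2 jk).
    by exists b1; split=> //; exists b2.
  apply: (contra b2 b2B) => [i /only[e _]|s b3 s_in b3B e3 i /only[e _]].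
    by rewrite e eqxx in d2.
  (* If [d] were a neighbour of [b2], a walk of three steps would close at [d], or a shorter one
     after merging steps. *)
  rewrite {b3 b3B}e in e3; have [l1 l2 _] := step_lt3 s s_in.
  have [ls|ls] := eqVneq l s.1; last first.
    have := three_steps_neq h B d (i1, j1) (k, l) s d Bconf dB s1 s2 s_in jk ls.
    rewrite eqxx => absurd; suff: false by [].
    by apply: absurd; exists b1; split=> //; exists b2; split=> //; exists d.
  rewrite -ls -e2 in e3; have [ks|ks] := eqVneq k s.2.
    by rewrite ks in e3; rewrite (mulgI _ _ _ e3) eqxx in b1d.
  have := two_steps_neq h B d (i1, j1) (k, s.2) d Bconf dB s1 (mem_steps _ _ k3 l2 ks) jk.
  rewrite eqxx => absurd; suff: false by [].
  by apply: absurd; exists b1; split=> //; exists d.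
have [b bB] : exists b, b \in B.
  by have := conf_neq0 _ _ _ Bconf; case: (B) => // b s _; exists b; rewrite mem_head.
by apply: (contra b bB) => [i unm|s b' _ _ _ i unm]; apply: nounm;
  [exists b | exists b']; exists i.
Qed.

Lemma no_configuration h B : ~ configuration G h B.
Proof.
move=> Bconf; apply: (far_vertex h B Bconf) => b bB b_matched near_matched.
have nbr i : (i < 3)%N -> exists b' j, [/\ b' \in B, (j < 3)%N, (i, j) \in steps &
    h i * b = h j * b'].
  move=> i3; have [/b_matched//|[b' [j [b'B j3 ji _ e]]]] :=
    unmatched_or_match _ _ _ _ _ Bconf bB i3.
  by exists b', j; split=> //; apply: mem_steps => //; rewrite eq_sym.
have [n0 [j0 [n0B j03 s0 e0]]] := nbr 0%N isT.
have [n1 [j1 [n1B j13 s1 e1]]] := nbr 1%N isT.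
have [n2 [j2 [n2B j23 s2 e2]]] := nbr 2 isT.
have neq_b s b' : s \in steps -> h s.1 * b = h s.2 * b' -> b != b'.
  exact: (step_neq h B b s b' Bconf).
have swapped s : s \in steps -> swap s \in steps.
  by move=> /step_lt3[l1 l2 l12]; apply: mem_steps => //; rewrite eq_sym.
(* The walk from one neighbour through [b] to the other is reduced, because it uses two different
   slots of [b]. *)
have neq_n s t m n : s \in steps -> t \in steps -> s.1 != t.1 -> m \in B -> n \in B ->
    h s.1 * b = h s.2 * m -> h t.1 * b = h t.2 * n -> m != n.
  move=> s_in t_in st mB nB es et.
  apply: (two_steps_neq h B m (swap s) t n Bconf mB (swapped s s_in) t_in st).
  by exists b; split=> //; exists n.
pose v := [:: b; n0; n1; n2].
pose gs : seq (seq slot) :=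
  [:: [:: (0, 0); (1, j0)]; [:: (0, 1); (2, j1)]; [:: (0, 2); (3, j2)]]%N.
have v_models : models G h B v gs.
  split=> /= [|x|g s|g s t|s].
  - rewrite !inE !negb_or (neq_b _ _ s0 e0) (neq_b _ _ s1 e1) (neq_b _ _ s2 e2).
    rewrite (neq_n _ _ _ _ s0 s1 _ n0B n1B e0 e1) // (neq_n _ _ _ _ s0 s2 _ n0B n2B e0 e2) //.
    by rewrite (neq_n _ _ _ _ s1 s2 _ n1B n2B e1 e2).
  - by rewrite !inE => /or4P[]/eqP->.
  - by rewrite !inE => /or3P[]/eqP->; rewrite !inE => /orP[]/eqP->.
  - by rewrite !inE => /or3P[]/eqP->; rewrite !inE => /orP[]/eqP-> /orP[]/eqP->.
  by rewrite !inE => /or3P[]/eqP.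
have v_saturated : saturated 4 G h B v gs.
  right; split=> // k i k4 i3.
  case: k k4 => [|[|[|[|//]]]] _ /=; first exact: b_matched.
  - exact: near_matched s0 n0B e0 i.
  - exact: near_matched s1 n1B e1 i.
  exact: near_matched s2 n2B e2 i.
have bad_excluded w : coloured w -> short_word [::] w -> ~ closed_walk G h B w.
  by move=> _ /excluded_short_word ex; apply: ex.
apply: (search_sound _ 4 4 G h B Bconf bad_excluded 24 false v gs v_models
  (fun _ => v_saturated)).
have in3 i : (i < 3)%N -> i \in colours by case: i => [|[|[|]]].
have j_neq i j : (i, j) \in steps -> (j == i) = false.
  by move=> /step_lt3[_ _]; rewrite eq_sym => /negPf.
move/allP: search_ball => /(_ j0 (in3 _ j03))/allP/(_ j1 (in3 _ j13))/allP/(_ j2 (in3 _ j23)).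
case: ifP => [|_ ball_v]; last exact: ball_v.
by rewrite (j_neq _ _ s0) (j_neq _ _ s1) (j_neq _ _ s2).
Qed.

End NoConfiguration.

(** * From the equation in the group algebra to a configuration *)

Local Open Scope fset_scope.
Local Open Scope ring_scope.

Lemma mcoeff_mul (G : groupType) (F : fieldType) (a b : group_algebra F G) (z : G) :
  mcoeff z (a * b) = \sum_(x <- msupp a) \sum_(y <- msupp b)
    (mcoeff x a * mcoeff y b) *+ ((x * y)%g == z).
Proof.
rewrite -[a * b]/(ga_mul a b) /ga_mul.
rewrite (big_morph (mcoeff z) (ga_coeffD z) (mcoeff0 z)).
apply: eq_bigr => x _; rewrite (big_morph (mcoeff z) (ga_coeffD z) (mcoeff0 z)).
by apply: eq_bigr => y _; rewrite ga_coeff_single.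
Qed.

Theorem corollary1p4 (G : groupType) (F : fieldType)
    (delta gamma : group_algebra F G) :
  torsion_free G -> #|` msupp delta| = 3%N -> delta * gamma = 1 ->
  (10 <= #|` msupp gamma|)%N.
Proof.
move=> tfG delta3 dg1; rewrite ltnNge; apply/negP => gamma9.
pose h (i : nat) : G := nth 1%g (msupp delta) i.
have hd i : (i < 3)%N -> h i \in msupp delta by move=> i3; rewrite mem_nth // delta3.
have coeff_dg z : mcoeff z (delta * gamma) = (z == 1%g)%:R.
  by rewrite dg1 -[1]/(ga_one F G) ga_coeff_single eq_sym.
(* An unmatched product has as coefficient a single product of two nonzero field elements, whereas
   [delta * gamma] vanishes away from 1. *)
have unm1 b i : unmatched G h (msupp gamma) b i -> (h i * b)%g = 1%g.
  move=> [bB i3 unm]; apply/eqP; apply: contraT => hb1.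
  have := coeff_dg (h i * b)%g; rewrite (negPf hb1) mcoeff_mul.
  rewrite (big_fsetD1 (h i)) /=; last exact: hd.
  rewrite (big_fsetD1 b) //= eqxx GRing.mulr1n.
  rewrite big1_fset => [|y]; last first.
    rewrite !inE => /andP[yb yB] _; case: eqP => // /mulgI e.
    by rewrite e eqxx in yb.
  rewrite GRing.addr0 big1_fset ?GRing.addr0 => [|x]; last first.
    rewrite !inE => /andP[xh xd] _; rewrite big1_fset // => y yB _.
    case: eqP => // e; have xE : x = h (index x (msupp delta)) by rewrite /h nth_index.
    have x3 : (index x (msupp delta) < 3)%N by rewrite -delta3 index_mem.
    have [_ xi] := unm y _ yB x3 (etrans (esym e) (congr1 (fun z => z * y)%g xE)).
    by rewrite xE -xi eqxx in xh.
  by move/eqP; rewrite GRing.mulf_eq0 !mcoeff_eq0 hd // bB.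
apply: (no_configuration G tfG h (msupp gamma)); split=> //.
- by move=> i j i3 j3 /eqP; rewrite nth_uniq ?delta3 ?fset_uniq // => /eqP.
- apply/eqP => gamma0; have /eqP := coeff_dg 1%g; rewrite mcoeff_mul eqxx.
  rewrite big1 ?(eq_sym 0) ?GRing.oner_eq0 // => x _; rewrite big1_fset // => y.
  by rewrite -[y \in _]/(y \in enum_fset _) gamma0.
(* Both unmatched products equal 1, so each matches the other and the pairs agree. *)
move=> b i b' i' unm unm'.
have [_ _ e] := unm; have [bB' i'3 _] := unm'.
by apply: e => //; rewrite (unm1 _ _ unm) (unm1 _ _ unm').
Qed.
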